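(* Let $\kappa\ge 2$ and suppose $q\ge (n+f)\,p_{\mathrm{vote}}/2$. Under partial synchrony (with $f=\epsilon n$, $\epsilon\in[0,1/3)$), a safety violation occurs for the QScale protocol with probability at most $$2^{\kappa-1}\cdot \exp\!\left(-\frac{\delta^2 (n+f)\,p_{\mathrm{vote}}}{2(2+\delta)}\right)^{\kappa-1},\qquad\text{where } \delta=\frac{2q}{(n+f)\,p_{\mathrm{vote}}}-1 .$$
   Context: System model. $\Pi$ is a set of $n$ processes, at most $f=\epsilon n$ of which are Byzantine (chosen once at the start by a static, computationally bounded adversary; they may collude but cannot forge signatures); the others are correct. Channels are reliable and point-to-point, clocks are synchronized, and execution proceeds in rounds. In the partially synchronous model the network and the processes may be asynchronous until an unknown global stabilization time, after which the system is synchronous with unknown time bounds. $\texttt{H}$ is a collision-resistant hash function. Parameters: probabilities $p_{\mathrm{sample}},p_{\mathrm{vote}},p_{\mathrm{prop}}\in(0,1]$, a quorum size $q$, an integer $\kappa$. All sampling and vote coins are independent; they are produced by a verifiable random function (VRF), so the outcomes are verifiable and cannot be biased by Byzantine processes. A random sample with probability $p$ contains each process independently with probability $p$. QScale protocol. A block is a tuple (epoch, txs, parent hash, height), linked by parent hashes to blocks of height one less, starting from the genesis block, which is certified. A certificate for a block is an aggregation of votes (signatures) of at least $q$ distinct processes for it. Epoch $e\ge1$ consists of rounds $3e-2$ (propose), $3e-1$ (disseminate), $3e$ (vote) and has a predetermined, publicly known leader. - Propose: the leader of epoch $e$ forms a certificate for the block proposed in epoch $e-1$ if it received at least $q$ votes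 for it, takes the certified block $N$ of greatest height it knows, creates a block extending $N$ (height one larger), and sends it together with the certificate of $N$ to a random sample with probability $p_{\mathrm{sample}}$ (the first-layer sample) and to the leader of epoch $e+1$. A receiver accepts the proposal if its transactions are valid, it comes from the leader of epoch $e$, and it extends a block the receiver has and for which the included certificate is valid. - Disseminate: each member of the first-layer sample that accepted the proposal forwards it to its own fresh random sample with probability $p_{\mathrm{sample}}$ and to the leader of epoch $e+1$. - Vote: a process that has received a valid proposal of epoch $e$ by the end of the disseminate round (and no conflicting one) is a candidate to vote for it; a correct process becomes a candidate at most once per epoch. Each candidate votes with probability $p_{\mathrm{vote}}$, by sending its vote to the leader of epoch $e+1$; a correct process votes only if all predecessors of the block are certified locally and it knows no certified block of height at least that of the proposed block. Once a correct process becomes a candidate for a proposal it is locked on the certified block contained in that proposal, and never votes for a block of height less than or equal to that of the locked block. - Propagation: in every round, every process sends the proposal of greatest height it has to a fresh random sample with probability $p_{\mathrm{prop}}$. - A process certifies a block $B$ when it has $B$ and receives a proposal containing a valid certificate for $B$. - Commit: a process commits $B_1$ and all its ancestors when it has certified blocks $B^1,\dots,B^k,B_1,\dots,B_\kappa$ ($k\ge0$) which, following the genesis block, form a chain (consecutive heights, linked by hashes), with $B_1,\dots,B_\kappa$ proposed in consecutive epochs, and it has no certified block $B$ with the same height as $B_1$ and $B.\mathrm{txs}\ne B_1.\mathrm{txs}$. Safety violation. Suppose a correct process $i$ commits $B_1$ through such a chain $B^1,\dots,B^k,B_1,\dots,B_\kappa$, where $B^1$ (or $B_1$ if $k=0$)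 extends the block of greatest height previously committed by $i$. A safety violation occurs when some correct process $j\ne i$ observes an alternative chain of certified blocks $B_1',\dots,B_\kappa'$ proposed in consecutive epochs, with $B_1.\mathrm{txs}\ne B_1'.\mathrm{txs}$ and $B_1.\mathrm{height}=B_1'.\mathrm{height}$, and $j$ commits $B_1'$.
   Formalization: The bound is proved for a safety violation at each fixed common height of B_1, B_1' and fixed pair of their epochs, not for a violation anywhere in the execution: before an arbitrarily late stabilization time the adversary can retry each epoch, so the unrestricted claim fails. *)

(* Defs.v *)
From HB Require Import structures.
From mathcomp Require Import all_boot all_order all_algebra.
From mathcomp Require Import all_classical all_reals all_analysis.

Set Implicit Arguments.
Unset Strict Implicit.
Unset Printing Implicit Defensive.

Import Order.TTheory GRing.Theory Num.Theory.

Local Open Scope classical_set_scope.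
Local Open Scope nat_scope.

(** * Coins

    Every random choice of the protocol is the value of a VRF on a public
    input: one vote coin per process and epoch, one sampling coin per process,
    round and potential recipient (no process draws two samples of the same
    kind in one round).  In particular the vote coin of a process does not
    depend on the block voted for, so a Byzantine process can neither re-toss
    it nor bias it by varying the block. *)

Inductive coin (n : nat) :=
  | VoteCoin of 'I_n & nat
  | SampleCoin of 'I_n & nat & 'I_n
  | PropCoin of 'I_n & nat & 'I_n.

Definition coin_code n (c : coin n) :
    'I_n * nat + ('I_n * nat * 'I_n + 'I_n * nat * 'I_n) :=
  match c with
  | VoteCoin p e => inl (p, e)
  | SampleCoin p r d => inr (inl (p, r, d))
  | PropCoin p r d => inr (inr (p, r, d))
  end.

Definition coin_decode n
    (x : 'I_n * nat + ('I_n * nat * 'I_n + 'I_n * nat * 'I_n)) : coin n :=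
  match x with
  | inl (p, e) => VoteCoin p e
  | inr (inl (p, r, d)) => SampleCoin p r d
  | inr (inr (p, r, d)) => PropCoin p r d
  end.

Lemma coin_codeK n : cancel (@coin_code n) (@coin_decode n).
Proof. by case. Qed.

HB.instance Definition _ n := Equality.copy (coin n) (can_type (@coin_codeK n)).

Definition coin_owner n (c : coin n) : 'I_n :=
  match c with VoteCoin p _ | SampleCoin p _ _ | PropCoin p _ _ => p end.

(* the epoch of a vote coin, the round of a sampling coin *)
Definition coin_time n (c : coin n) : nat :=
  match c with VoteCoin _ t | SampleCoin _ t _ | PropCoin _ t _ => t end.

Section Independence.
Local Open Scope ring_scope.
Variables (R : realType) (n : nat).

Definition coin_bias (p_sample p_vote p_prop : R) (c : coin n) : R :=
  match c with
  | VoteCoin _ _ => p_vote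
  | SampleCoin _ _ _ => p_sample
  | PropCoin _ _ _ => p_prop
  end.

(* The events [toss c] are mutually independent, [toss c] having probability
   [bias c]. *)
Definition independent_coins d (T : measurableType d) (P : probability T R)
    (bias : coin n -> R) (toss : coin n -> T -> bool) : Prop :=
  (forall c, measurable [set w | toss c w]) /\
  (forall s : seq (coin n), uniq s ->
     P [set w | all (fun c => toss c w) s] = (\prod_(c <- s) bias c)%:E).
End Independence.

(** * Blocks and static data of the protocol *)

Record block (Tx Hash : Type) := Block {
  b_epoch : nat;
  b_txs : Tx;
  b_parent : Hash;
  b_height : nat }.

Definition block_code Tx Hash (B : block Tx Hash) :=
  (b_epoch B, b_txs B, b_parent B, b_height B).
Definition block_decode Tx Hash (x : nat * Tx * Hash * nat) :=
  let: (e, t, p, h) := x in Block e t p h.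
Lemma block_codeK Tx Hash : cancel (@block_code Tx Hash) (@block_decode Tx Hash).
Proof. by case. Qed.

HB.instance Definition _ (Tx Hash : eqType) :=
  Equality.copy (block Tx Hash) (can_type (@block_codeK Tx Hash)).

Record protocol (n : nat) (Tx Hash : eqType) := Protocol {
  leader : nat -> 'I_n;
  hash : block Tx Hash -> Hash;
  valid_txs : pred Tx;
  genesis : block Tx Hash;
  quorum : nat;
  kappa : nat }.

Section QScale.
Variables (n : nat) (Tx Hash : eqType).
Variables (pr : protocol n Tx Hash) (byz : {set 'I_n}).

Notation block := (block Tx Hash).
Notation H := (hash pr).
Notation G := (genesis pr).

(* a certificate: the certified block and the processes whose signatures are
   aggregated *)
Definition cert : Type := (block * {set 'I_n})%type.
(* a proposal: a block and the certificate of its parent *)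
Definition proposal : Type := (block * cert)%type.

Inductive msg :=
  | MProposal of proposal
  | MVote of 'I_n & block.

Definition msg_code (m : msg) : proposal + 'I_n * block :=
  match m with MProposal x => inl x | MVote v B => inr (v, B) end.
Definition msg_decode (x : proposal + 'I_n * block) : msg :=
  match x with inl x => MProposal x | inr (v, B) => MVote v B end.
Lemma msg_codeK : cancel msg_code msg_decode.
Proof. by case. Qed.

HB.instance Definition _ := Equality.copy msg (can_type msg_codeK).

(* source, destination, content *)
Definition packet : Type := ('I_n * 'I_n * msg)%type.

Definition extends (N B : block) : bool :=
  (b_parent B == H N) && (b_height B == (b_height N).+1).

(** * States *)

(* Local state of a correct process.  [l_round] is the last round executed,
   [l_props] the accepted proposals (oldest first), [l_certs] the valid
   certificates received, [l_ballots] the valid votes received as a leader,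
   [l_locks] all blocks the process has ever been locked on, [l_cast] the blocks
   it voted for, [l_made] the proposals it issued as a leader. *)
Record local := Local {
  l_round : nat;
  l_props : seq proposal;
  l_certs : seq cert;
  l_ballots : seq ('I_n * block);
  l_locks : seq block;
  l_cast : seq block;
  l_made : seq proposal }.

(* [s_sent] is the log of all packets sent by correct processes *)
Record state := State {
  s_loc : {ffun 'I_n -> local};
  s_sent : seq packet }.

Definition init_local : local := Local 0 [::] [::] [::] [::] [::] [::].
Definition init_state : state := State [ffun=> init_local] [::].

Definition has_block (l : local) (B : block) : bool :=
  (B == G) || (B \in [seq x.1 | x <- l_props l]).

Definition certified (l : local) : seq block :=
  G :: [seq c.1 | c <- l_certs l & has_block l c.1].

(** * Signatures *)

Section Step.
Variable toss : coin n -> bool.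

(* A vote of a correct process exists only if that process cast it; a Byzantine
   process may sign any vote at any time, but the vote is accepted only together
   with a VRF proof that its vote coin for the epoch of the block is heads. *)
Definition vote_ok (s : state) (v : 'I_n) (B : block) : bool :=
  if v \in byz then toss (VoteCoin v (b_epoch B)) else B \in l_cast (s_loc s v).

Definition valid_cert (s : state) (c : cert) : bool :=
  (c.1 == G) ||
  ((quorum pr <= #|c.2|) && [forall v, (v \in c.2) ==> vote_ok s v c.1]).

(* unforgeability: which messages can bear the signatures they need *)
Definition authentic (s : state) (m : msg) : bool :=
  match m with
  | MProposal x =>
      let p := leader pr (b_epoch x.1) in
      (0 < b_epoch x.1) && ((p \in byz) || (x \in l_made (s_loc s p)))
  | MVote v B => (v \in byz) || (B \in l_cast (s_loc s v))
  end.

(* A packet from a correct process must have been sent by it; Byzantine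
   processes may send any message without forged signatures. *)
Definition deliverable (s : state) (pk : packet) : bool :=
  let: (src, _, m) := pk in
  if src \in byz then authentic s m else pk \in s_sent s.

(** * Reception *)

Definition receive_proposal (s : state) (x : proposal) (l : local) : local :=
  let: (B, c) := x in
  if ~~ valid_cert s c then l else
  let accept := [&& valid_txs pr (b_txs B), has_block l c.1 & extends c.1 B] in
  Local (l_round l)
        (if accept && (x \notin l_props l) then rcons (l_props l) x
         else l_props l)
        (if c \in l_certs l then l_certs l else rcons (l_certs l) c)
        (l_ballots l) (l_locks l) (l_cast l) (l_made l).

Definition receive (s : state) (m : msg) (l : local) : local :=
  match m with
  | MProposal x => receive_proposal s x l
  | MVote v B =>
      if vote_ok s v B then
        Local (l_round l) (l_props l) (l_certs l) ((v, B) :: l_ballots l)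
              (l_locks l) (l_cast l) (l_made l)
      else l
  end.

(** * Rounds

    Rounds 3e-2, 3e-1 and 3e make up epoch e. *)

Definition epoch_of (r : nat) : nat := (r + 2) %/ 3.

(* destinations: a random sample, plus the leader of epoch [e + 1] *)
Definition to_sample (p : 'I_n) (r e : nat) (m : msg) : seq packet :=
  [seq (p, d, m) | d <- enum 'I_n & toss (SampleCoin p r d) || (d == leader pr e.+1)].

(* the first element of greatest height *)
Definition highest (A : Type) (ht : A -> nat) (x : A) (s : seq A) : A :=
  foldl (fun y z => if ht y < ht z then z else y) x s.

Definition formed_certs (l : local) (e : nat) : seq cert :=
  let voters B : {set 'I_n} := finset (fun v => (v, B) \in l_ballots l) in
  [seq (B, voters B) | B <- [seq x.1 | x <- l_props l]
                     & (b_epoch B == e.-1) && (quorum pr <= #|voters B|)].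

Definition propose (s : state) (p : 'I_n) (r : nat) (txs : Tx) (l : local) :
    local * seq packet :=
  let e := epoch_of r in
  if (p == leader pr e) && valid_txs pr txs then
    let N := highest (fun c : cert => b_height c.1) (G, finset.set0)
               ([seq c <- l_certs l | has_block l c.1] ++ formed_certs l e) in
    let x := (Block e txs (H N.1) (b_height N.1).+1, N) in
    let l' := receive_proposal s x l in
    (Local (l_round l') (l_props l') (l_certs l') (l_ballots l') (l_locks l')
           (l_cast l') (x :: l_made l'),
     to_sample p r e (MProposal x))
  else (l, [::]).

Definition epoch_props (l : local) (e : nat) : seq proposal :=
  [seq x <- l_props l | b_epoch x.1 == e].

(* The process forwards if it belongs to the sample drawn by the leader in the
   previous round. *)
Definition disseminate (p : 'I_n) (r : nat) (l : local) : local * seq packet :=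
  let e := epoch_of r in
  if toss (SampleCoin (leader pr e) r.-1 p) then
    (l, flatten [seq to_sample p r e (MProposal x) | x <- epoch_props l e])
  else (l, [::]).

Definition predecessors_certified (l : local) (B : block) : Prop :=
  exists s : seq block,
    all [in certified l] s /\ path extends G (rcons s B).

(* A candidate is locked on the parent [x.2.1] of its candidate block, whether
   or not it votes. *)
Definition vote (p : 'I_n) (r : nat) (l : local) : local * seq packet :=
  let e := epoch_of r in
  if epoch_props l e is x :: xs then
    if all (fun y => y.1 == x.1) xs then
      let B := x.1 in
      let locks := x.2.1 :: l_locks l in
      if [&& toss (VoteCoin p e), `[< predecessors_certified l B >],
             all (fun C => b_height C < b_height B) (certified l)
           & all (fun L => b_height L < b_height B) locks]
      then (Local (l_round l) (l_props l) (l_certs l) (l_ballots l) locks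
                  (B :: l_cast l) (l_made l),
            [:: (p, leader pr e.+1, MVote p B)])
      else (Local (l_round l) (l_props l) (l_certs l) (l_ballots l) locks
                  (l_cast l) (l_made l), [::])
    else (l, [::])
  else (l, [::]).

Definition propagate (p : 'I_n) (r : nat) (l : local) : seq packet :=
  if l_props l is x :: xs then
    let y := highest (fun z : proposal => b_height z.1) x xs in
    [seq (p, d, MProposal y) | d <- enum 'I_n & toss (PropCoin p r d)]
  else [::].

Definition play_round (s : state) (p : 'I_n) (r : nat) (txs : Tx) (l : local) :
    local * seq packet :=
  let: (l', out) :=
    match r %% 3 with
    | 1 => propose s p r txs l
    | 2 => disseminate p r l
    | _ => vote p r l
    end in
  (Local r (l_props l') (l_certs l') (l_ballots l') (l_locks l') (l_cast l')
         (l_made l'),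
   out ++ propagate p r l').

(** * Transitions

    The scheduler is adversarial.  At each tick it either delivers one packet to
    a correct process or lets a correct process execute a round [r] later than
    the last one it executed; a slow process may thus lag behind or skip rounds.
    The payload [txs] of a proposed block comes from the environment.  Illegal
    actions have no effect. *)

Inductive action :=
  | Deliver of packet
  | Round of 'I_n & nat & Tx.

Definition set_local (s : state) (p : 'I_n) (l : local) (out : seq packet) :
    state :=
  State [ffun p' => if p' == p then l else s_loc s p'] (s_sent s ++ out).

Definition step (s : state) (a : action) : state :=
  match a with
  | Deliver (src, dst, m) =>
      if (dst \notin byz) && deliverable s (src, dst, m) then
        set_local s dst (receive s m (s_loc s dst)) [::]
      else s
  | Round p r txs =>
      if (p \notin byz) && (l_round (s_loc s p) < r) then
        let: (l, out) := play_round s p r txs (s_loc s p) in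
        set_local s p l out
      else s
  end.

End Step.

(** * Adversary and executions

    At tick [t] the adversary knows all past states, hence the outcome of every
    coin revealed by a correct process, and the coins of the Byzantine processes
    for epochs and rounds below [lookahead t]: it can evaluate their VRFs ahead
    of time, finitely many by any given tick. *)

Record adversary := Adversary {
  lookahead : nat -> nat;
  adv_act : (coin n -> bool) -> seq state -> action }.

Section Execution.
Variables (A : adversary) (toss : coin n -> bool).

Definition byz_view (k : nat) (c : coin n) : bool :=
  [&& coin_owner c \in byz, coin_time c < k & toss c].

(* the states at ticks [t], ..., 1, 0 *)
Fixpoint trace (t : nat) : seq state :=
  if t is t'.+1 then
    let past := trace t' in
    step toss (head init_state past)
         (adv_act A (byz_view (lookahead A t')) past) :: past
  else [:: init_state].

Definition run (t : nat) : state := head init_state (trace t).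

(* the action performed between [run t] and [run t.+1] *)
Definition act_at (t : nat) : action :=
  adv_act A (byz_view (lookahead A t)) (trace t).

(** From an unknown tick [GST] on, packets between correct processes take at
    most an unknown time [D], no correct process stops for longer than [D], and
    the processes go through the rounds in the same order. *)
Definition partially_synchronous : Prop :=
  exists GST D : nat,
  [/\ forall t src dst m,
        (src, dst, m) \in drop (size (s_sent (run t))) (s_sent (run t.+1)) ->
        dst \notin byz ->
        exists t', t < t' <= maxn t GST + D /\ act_at t' = Deliver (src, dst, m),
      forall t p, GST <= t -> p \notin byz ->
        exists t' r txs,
          [/\ t <= t' <= t + D, l_round (s_loc (run t') p) < r
            & act_at t' = Round p r txs]
    & forall t t' p p' r r' txs txs', GST <= t <= t' ->
        p \notin byz -> p' \notin byz ->
        act_at t = Round p r txs -> act_at t' = Round p' r' txs' -> r <= r'].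

(** * Commit and safety violation *)

(* The local state [l] allows to commit [B1] through the chain
   [anc ++ B1 :: bs], which follows the genesis block. *)
Definition commits_through (l : local) (anc : seq block) (B1 : block)
    (bs : seq block) : Prop :=
  [/\ path extends G (anc ++ B1 :: bs),
      all [in certified l] (anc ++ B1 :: bs),
      size (B1 :: bs) = kappa pr,
      path (fun B B' => b_epoch B' == (b_epoch B).+1) B1 bs
    & forall B, B \in certified l -> b_height B = b_height B1 ->
        b_txs B = b_txs B1].

Definition committed_before (p : 'I_n) (t : nat) (B : block) : Prop :=
  B = G \/
  exists t0 anc B1 bs,
    [/\ t0 < t, commits_through (s_loc (run t0) p) anc B1 bs
      & B \in rcons anc B1].

(* A safety violation between a block [B1] of epoch [e] committed by [i] and a
   block [B1'] of epoch [e'] committed by [j], both of height [h].  The part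
   [pre ++ B1 :: bs] of the chain of [i] extends the block of greatest height
   that [i] committed previously.  The position [(h, e, e')] of the two blocks is
   a parameter and everything else is existential: before GST, which may be
   arbitrarily late, a conflicting chain can be attempted afresh in every epoch,
   so only the probability of a violation at a given position can be bounded
   independently of the length of the execution. *)
Definition safety_violation (h e e' : nat) : Prop :=
  exists (i j : 'I_n) (t t' : nat) (anc pre : seq block) (B1 : block)
         (bs anc' : seq block) (B1' : block) (bs' : seq block),
  [/\ [/\ i \notin byz, j \notin byz & i != j],
      commits_through (s_loc (run t) i) (anc ++ pre) B1 bs,
      committed_before i t (last G anc) /\
      (forall B, committed_before i t B -> b_height B <= b_height (last G anc)),
      commits_through (s_loc (run t') j) anc' B1' bs'
    & [/\ b_txs B1 != b_txs B1', b_height B1 = h, b_height B1' = h,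
          b_epoch B1 = e & b_epoch B1' = e']].

End Execution.
End QScale.

(* Main.v *)
Require Import Defs.
From mathcomp Require Import all_boot all_order all_algebra.
From mathcomp Require Import all_classical all_reals all_analysis.
From mathcomp Require Import zify ring lra.

Set Implicit Arguments.
Unset Strict Implicit.
Unset Printing Implicit Defensive.

Import Order.TTheory GRing.Theory Num.Theory.
Import numFieldNormedType.Exports.

Local Open Scope classical_set_scope.
Local Open Scope ring_scope.

(** By symmetry, [e <= e'].  Put [K = kappa - 1].  If [e < e'], pair the block of
    height [h + k + 1] of the chain starting in epoch [e] with the block of height
    [h + k] of the other chain, for [k < K]; if [e = e'], pair the blocks of equal
    height.  A correct process that is a candidate for the first block of a pair is
    locked at the height of the second one (and, if [e = e'], votes only once in the
    common epoch), so it contributes at most one vote to each pair, with a coin that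
    nobody has seen when the process becomes a candidate.  A
    Byzantine process contributes at most two votes to each pair, with coins that
    may be known in advance but cannot be chosen.  Hence the total number of votes,
    which must reach [2 K q], is dominated by [K (n - |byz|)] fresh coins plus two
    sums of [K |byz|] coins.  The exponential moment of the adaptively chosen part
    is controlled by a martingale, and the Chernoff bound for weights 1 and 2
    concludes, even without the factor [2 ^ K].  Only the position [(h, e, e')] of
    the blocks matters for which coins are counted, so no union over blocks is
    needed. *)

(** * Coin assignments and dependence on finitely many coins *)

Section Update.
Variable I : eqType.
Implicit Types (w : I -> bool) (c : I) (s : seq I).

Definition upd w c x : I -> bool := fun c' => if c' == c then x else w c'.

Lemma upd_same w c x : upd w c x c = x.
Proof. by rewrite /upd eqxx. Qed.

Lemma upd_other w c x c' : c' != c -> upd w c x c' = w c'.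
Proof. by rewrite /upd => /negbTE->. Qed.

Lemma upd_upd w c x y : upd (upd w c x) c y = upd w c y.
Proof. by apply: funext => c'; rewrite /upd; case: eqP. Qed.

Lemma upd_id w c : upd w c (w c) = w.
Proof. by apply: funext => c'; rewrite /upd; case: eqP => [->|]. Qed.

Lemma updC w c x c' y : c != c' ->
  upd (upd w c x) c' y = upd (upd w c' y) c x.
Proof.
move=> ncc'; apply: funext => d; rewrite /upd.
by case: (d =P c') => // ->; case: (c' =P c) ncc' => // ->; rewrite eqxx.
Qed.

Definition determined_by (X : Type) s (F : (I -> bool) -> X) :=
  forall w w', {in s, w =1 w'} -> F w = F w'.

Lemma determined_by_sub (X : Type) s s' (F : (I -> bool) -> X) :
  {subset s <= s'} -> determined_by s F -> determined_by s' F.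
Proof. by move=> ss' dF w w' ww'; apply: dF => c /ss'/ww'. Qed.

Lemma determined_by_upd (X : Type) c s x (F : (I -> bool) -> X) :
  determined_by (c :: s) F -> determined_by s (fun w => F (upd w c x)).
Proof.
move=> dF w w' ww'; apply: dF => c'; rewrite inE /upd.
by case: eqP => //= _ /ww'.
Qed.

(** Fixing the first coin either way leaves a function of fewer coins; the sum of the two bounds
    serves both cases. *)
Lemma determined_by_bounded s (F : (I -> bool) -> nat) :
  determined_by s F -> exists M, forall w, (F w <= M)%N.
Proof.
elim: s F => [|c s IHs] F dF; first by exists (F xpredT) => w; rewrite (dF w xpredT).
have [M1 HM1] := IHs _ (determined_by_upd true dF).
have [M0 HM0] := IHs _ (determined_by_upd false dF).
exists (M1 + M0)%N => w; rewrite -(upd_id w c); case: (w c).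
  exact: leq_trans (HM1 w) (leq_addr _ _).
exact: leq_trans (HM0 w) (leq_addl _ _).
Qed.

End Update.

(** * Expectation over a finite list of independent coins *)

Section Expect.
Variables (I : eqType) (R : numDomainType) (b : I -> R).
Implicit Types (w : I -> bool) (c : I) (s : seq I) (F G : (I -> bool) -> R).

(* The expectation of [F] when the coins of [s] are tossed independently and
   every other coin keeps its value in [w]. *)
Fixpoint expect s F w : R :=
  if s is c :: s' then
    b c * expect s' F (upd w c true) + (1 - b c) * expect s' F (upd w c false)
  else F w.

Lemma eq_expect s F G w : F =1 G -> expect s F w = expect s G w.
Proof. by move=> FG; elim: s w => [|c s IHs] w //=; rewrite !IHs. Qed.

Lemma expectD s F G w :
  expect s (fun v => F v + G v) w = expect s F w + expect s G w.
Proof.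
elim: s w => [|c s IHs] w //=.
by rewrite !IHs !mulrDr addrACA.
Qed.

Lemma expectZ s a F w : expect s (fun v => a * F v) w = a * expect s F w.
Proof.
elim: s w => [|c s IHs] w //=.
by rewrite !IHs mulrDr !mulrA ![_ * a]mulrC.
Qed.

Lemma expect_cst s a w : expect s (fun=> a) w = a.
Proof.
elim: s w => [|c s IHs] w //=.
by rewrite !IHs -mulrDl addrC subrK mul1r.
Qed.

Lemma expect_sum (J : Type) (r : seq J) (F : J -> (I -> bool) -> R) s w :
  expect s (fun v => \sum_(j <- r) F j v) w = \sum_(j <- r) expect s (F j) w.
Proof.
elim: r => [|j r IHr].
  rewrite big_nil -[RHS](expect_cst s 0 w).
  by apply: eq_expect => v; rewrite big_nil.
rewrite big_cons -IHr -expectD.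
by apply: eq_expect => v; rewrite big_cons.
Qed.

Lemma expect_upd s F c x w : (forall v y, F (upd v c y) = F v) ->
  expect s F (upd w c x) = expect s F w.
Proof.
move=> Fc; elim: s w => [|c' s IHs] w //=.
have [->|ncc'] := eqVneq c' c; first by rewrite !upd_upd.
by rewrite !(updC _ _ _ (_ : c != c')) 1?eq_sym // !IHs.
Qed.

Lemma expect_shift s F c x w : c \notin s ->
  expect s (fun v => F (upd v c x)) w = expect s F (upd w c x).
Proof.
elim: s w => [|c' s IHs] w //=; rewrite inE negb_or => /andP[ncc' cs].
by rewrite !IHs // !(updC _ _ _ ncc').
Qed.

Lemma expect_pull s (g : bool -> R) F c w : c \notin s ->
  expect s (fun v => g (v c) * F v) w = g (w c) * expect s F w.
Proof.
elim: s w => [|c' s IHs] w //=.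
rewrite inE negb_or => /andP[ncc' cs]; rewrite !IHs // !upd_other //.
by rewrite mulrDr !mulrA ![_ * g _]mulrC.
Qed.

(** When the recursion reaches [c], both branches see the same expectation of [F], so only the mean
    of [g] at [c] remains as a factor. *)
Lemma expect_coin s (g : bool -> R) F c w : uniq s -> c \in s ->
  (forall v y, F (upd v c y) = F v) ->
  expect s (fun v => g (v c) * F v) w =
  (b c * g true + (1 - b c) * g false) * expect s F w.
Proof.
move=> us cs Fc; elim: s us cs w => [|c' s IHs] //= /andP[c's us].
rewrite inE => cs w; have [ecc'|ncc'] := eqVneq c c'.
  rewrite -ecc' in c's *.
  by rewrite !expect_pull // !upd_same !expect_upd //; ring.
move: cs; rewrite (negbTE ncc') /= => cs.
by rewrite !IHs //; ring.
Qed.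

Lemma expect_prod s (g : bool -> R) (L : seq I) w :
  uniq s -> uniq L -> {subset L <= s} ->
  expect s (fun v => \prod_(c <- L) g (v c)) w =
  \prod_(c <- L) (b c * g true + (1 - b c) * g false).
Proof.
move=> us; elim: L => [|c L IHL] /=.
  move=> _ _; rewrite big_nil -[RHS](expect_cst s 1 w).
  by apply: eq_expect => v; rewrite big_nil.
move=> /andP[cL uL] Ls; rewrite big_cons -IHL //; last first.
  by move=> d dL; apply: Ls; rewrite inE dL orbT.
rewrite -expect_coin ?Ls ?mem_head //.
  by apply: eq_expect => v; rewrite big_cons.
move=> v y; apply: eq_big_seq => d dL; rewrite upd_other //.
by apply: contraNneq cL => <-.
Qed.

(* Optional stopping in one step: the coin selected by [C] contributes a factor of
   mean [1], because neither its selection nor [F] depends on its value. *)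
Lemma expect_step s (rho : bool -> R) F (C : (I -> bool) -> option I) w :
  uniq s ->
  (forall v c, C v = Some c -> [/\ c \in s,
     b c * rho true + (1 - b c) * rho false = 1 &
     forall y, C (upd v c y) = Some c /\ F (upd v c y) = F v]) ->
  expect s (fun v => (if C v is Some c then rho (v c) else 1) * F v) w =
  expect s F w.
Proof.
move=> us HC.
(* Partition by the selected coin: on each piece the coin is a fixed one, so [expect_coin]
   applies. *)
have split_sel (h : I -> (I -> bool) -> R) v :
    (if C v is Some c then h c v else 1) * F v =
    (C v == None)%:R * F v +
    \sum_(c <- s) h c v * ((C v == Some c)%:R * F v).
  case Cv: (C v) => [c|] /=; last first.
    by rewrite big1 ?addr0 // => c _; rewrite /= mul0r mulr0.
  have [cs _ _] := HC _ _ Cv.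
  rewrite mul0r add0r (bigD1_seq c) //= eqxx mul1r big1 ?addr0 // => c' nc'c.
  case: eqP => [[ecc']|]; first by rewrite ecc' eqxx in nc'c.
  by rewrite mul0r mulr0.
rewrite (eq_expect _ _ (split_sel (fun c v => rho (v c)))) expectD expect_sum.
transitivity (expect s (fun v => (C v == None)%:R * F v +
    \sum_(c <- s) 1 * ((C v == Some c)%:R * F v)) w); last first.
  apply: eq_expect => v; rewrite -(split_sel (fun _ _ => 1)).
  by case: (C v); rewrite mul1r.
rewrite expectD expect_sum; congr (_ + _); apply: eq_big_seq => c cs.
rewrite expectZ mul1r.
(* The mean 1 of [rho] is known only for coins that are selected somewhere; the term of any other
   coin vanishes. *)
have [[v Cv]|nC] := pselect (exists v, C v = Some c).
  rewrite expect_coin //; last move=> u y.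
    by have [_ -> _] := HC _ _ Cv; rewrite mul1r.
  have [Cu|nCu] := eqVneq (C u) (Some c).
    by have [_ _ /(_ y)[-> ->]] := HC _ _ Cu; rewrite eqxx.
  (* Being selected is invariant in both directions: restoring the value of [c] would select [c] in
     [u] as well. *)
  have [Cu|nCu'] := eqVneq (C (upd u c y)) (Some c); last by rewrite !mul0r.
  have [_ _ /(_ (u c))[]] := HC _ _ Cu.
  by rewrite upd_upd upd_id => Cu'; rewrite Cu' eqxx in nCu.
have zero u : (C u == Some c)%:R * F u = 0.
  by case: eqP => [Cu|]; [case: nC; exists u | rewrite mul0r].
rewrite (eq_expect _ _ zero) -(eq_expect s w (F := fun=> 0)) //.
by move=> u; rewrite zero mulr0.
Qed.

Hypothesis b01 : forall c, 0 <= b c <= 1.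

Lemma le_expect s F G w : (forall v, F v <= G v) ->
  expect s F w <= expect s G w.
Proof.
move=> FG; elim: s w => [|c s IHs] w //=; have /andP[b0 b1] := b01 c.
by apply: lerD; apply: ler_wpM2l; rewrite ?subr_ge0.
Qed.

End Expect.

(** * From the probability space to finite expectations *)

Section Probability.
Variables (R : realType) (n : nat) (d : measure_display) (T : measurableType d).
Variables (P : probability T R) (b : coin n -> R) (toss : coin n -> T -> bool).
Hypothesis indep : independent_coins P b toss.
Let coins w : coin n -> bool := fun c => toss c w.

Lemma measurable_all_coins (s : seq (coin n)) :
  measurable [set w | all (coins w) s].
Proof.
elim: s => [|c s IHs] /=; first by rewrite (_ : [set _ | _] = setT) //; exact/seteqP.
rewrite (_ : [set w | _] = [set w | toss c w] `&` [set w | all (coins w) s]).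
  by apply: measurableI => //; case: indep.
by apply/seteqP; split => w /=; [move=> /andP[]|case=> ? ?; apply/andP].
Qed.

Lemma determined_by_split c (Q : (coin n -> bool) -> Prop) :
  [set w | Q (coins w)] =
  ([set w | toss c w] `&` [set w | Q (upd (coins w) c true)]) `|`
  ([set w | Q (upd (coins w) c false)] `\` [set w | toss c w]).
Proof.
have Qupd w : Q (upd (coins w) c (toss c w)) = Q (coins w).
  by congr Q; exact: upd_id.
apply/seteqP; split => w /=; rewrite -Qupd.
  by case: (toss c w) => Qw; [left|right].
by move=> [[-> //]|[Qw /negP/negbTE->]].
Qed.

Lemma measurable_determined (s : seq (coin n)) (Q : (coin n -> bool) -> Prop) :
  determined_by s Q -> measurable [set w | Q (coins w)].
Proof.
elim: s Q => [|c s IHs] Q dQ.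
  have [Q0|nQ0] := pselect (Q xpredT).
    rewrite (_ : [set w | _] = setT) //; apply/seteqP; split => w //= _.
    by rewrite (dQ _ xpredT).
  rewrite (_ : [set w | _] = set0) //; apply/seteqP; split => w //=.
  by rewrite (dQ _ xpredT).
rewrite (determined_by_split c); apply: measurableU.
  apply: measurableI; first by case: indep.
  exact: (IHs (fun v => Q (upd v c true)) (determined_by_upd _ dQ)).
apply: measurableD; last by case: indep.
exact: (IHs (fun v => Q (upd v c false)) (determined_by_upd _ dQ)).
Qed.

(** Independence is given for heads only, so the induction carries a list [u] of coins required to
    be heads. If [c] is heads, it joins [u]; the case of tails is the difference of two events that
    mention no tails. *)
Lemma probability_determined_cond (u s : seq (coin n))
    (Q : (coin n -> bool) -> Prop) w0 :
  uniq (u ++ s) -> determined_by s Q ->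
  P ([set w | all (coins w) u] `&` [set w | Q (coins w)]) =
  ((\prod_(c <- u) b c) * expect b s (fun v => `[<Q v>]%:R) w0)%:E.
Proof.
elim: s u Q w0 => [|c s IHs] u Q w0.
  rewrite cats0 => uu dQ; have [Q0|nQ0] := pselect (Q w0).
    rewrite /= asboolT // mulr1 (_ : [set w | Q _] = setT) ?setIT.
      by rewrite [LHS](proj2 indep).
    by apply/seteqP; split => w //= _; rewrite (dQ _ w0).
  rewrite /= asboolF // mulr0 (_ : [set w | Q _] = set0) ?setI0 ?measure0 //.
  by apply/seteqP; split => w //=; rewrite (dQ _ w0).
move=> ucs dQ.
have ucs' : uniq ((c :: u) ++ s) by rewrite -cat1s -catA uniq_catCA.
have us : uniq (u ++ s) by case/andP: ucs'.
have dQx x : determined_by s (fun w => Q (upd w c x)) by exact: determined_by_upd.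
have mu := measurable_all_coins u.
have mQx x : measurable [set w | Q (upd (coins w) c x)].
  exact: measurable_determined (dQx x).
have mc : measurable [set w | toss c w] by case: indep.
have cs : c \notin s by case/andP: ucs'; rewrite mem_cat => /norP[].
have exQ x v := expect_shift b (fun v => `[<Q v>]%:R : R) x v cs.
set U := [set w | all _ u].
set C := [set w | toss c w] in mc *.
set Q1 := [set w | Q (upd (coins w) c true)].
set Q0 := [set w | Q (upd (coins w) c false)].
have PUCQ x : P (U `&` C `&` [set w | Q (upd (coins w) c x)]) =
    (b c * (\prod_(c <- u) b c) *
     expect b s (fun v => `[<Q v>]%:R) (upd w0 c x))%:E.
  have := IHs (c :: u) _ w0 ucs' (dQx x); rewrite big_cons exQ => <-.
  congr (P (_ `&` _)); apply/seteqP; split => w /=.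
    by move=> [? ?]; apply/andP.
  by move=> /andP[].
rewrite (determined_by_split c) -/Q1 -/Q0 -/C setIUr setIDA setIA.
rewrite measureU; [| | | ]; last first.
- by apply/seteqP; split => w //=; tauto.
- by apply: measurableD => //; apply: measurableI => //; exact: (mQx false).
- by apply: measurableI; [exact: measurableI|exact: (mQx true)].
have PD : (P ((U `&` Q0) `\` C) = P (U `&` Q0) - P (U `&` C `&` Q0))%E.
  rewrite measureD //; first by rewrite setIAC.
    by apply: measurableI => //; exact: (mQx false).
  by rewrite (le_lt_trans (probability_le1 _ _)) ?ltry //;
     apply: measurableI => //; exact: (mQx false).
transitivity (P (U `&` C `&` Q1) + P ((U `&` Q0) `\` C))%E => //.
rewrite PD (PUCQ true) (PUCQ false) (IHs u _ w0 us (dQx false)) exQ /=.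
by rewrite -EFinB -EFinD; congr (_%:E); ring.
Qed.

Lemma probability_determined (s : seq (coin n)) (Q : (coin n -> bool) -> Prop) w0 :
  uniq s -> determined_by s Q ->
  P [set w | Q (coins w)] = (expect b s (fun v => `[<Q v>]%:R) w0)%:E.
Proof.
move=> us dQ; have := @probability_determined_cond [::] s Q w0 us dQ.
rewrite big_nil mul1r => <-; congr (P _).
by apply/seteqP; split => w //=; case.
Qed.

End Probability.

(** * Coins read by a single transition *)

Section Protocol.
Local Open Scope nat_scope.
Variables (n : nat) (Tx Hash : eqType).
Variables (pr : protocol n Tx Hash) (byz : {set 'I_n}).
Implicit Types (toss : coin n -> bool) (s : state n Tx Hash)
  (l : local n Tx Hash) (a : action n Tx Hash) (B : block Tx Hash)
  (p v : 'I_n).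

Local Notation vote_ok := (vote_ok byz).
Local Notation valid_cert := (valid_cert pr byz).
Local Notation step := (step pr byz).

Lemma epoch_of_vote E : epoch_of (3 * E) = E.
Proof. by rewrite /epoch_of; lia. Qed.

(* The vote coin of a correct process is read only when this process executes the
   vote round of the epoch of the coin. *)
Definition readable a (c : coin n) : bool :=
  if c is VoteCoin v E then
    (v \in byz) || (if a is Round p r _ then (p == v) && (r == 3 * E) else false)
  else true.

Lemma vote_ok_agree toss toss' s v B :
  (v \in byz -> toss (VoteCoin v (b_epoch B)) = toss' (VoteCoin v (b_epoch B))) ->
  vote_ok toss s v B = vote_ok toss' s v B.
Proof. by rewrite /Defs.vote_ok; case: ifP => // _ ->. Qed.

Lemma valid_cert_agree toss toss' s c :
  (forall v, v \in byz -> toss (VoteCoin v (b_epoch c.1)) =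
                          toss' (VoteCoin v (b_epoch c.1))) ->
  valid_cert toss s c = valid_cert toss' s c.
Proof.
move=> tt'; rewrite /Defs.valid_cert; congr (_ || (_ && _)).
by apply: eq_forallb => v; rewrite (vote_ok_agree _ (tt' v)).
Qed.

Lemma receive_proposal_agree toss toss' s x l :
  (forall v, v \in byz -> toss (VoteCoin v (b_epoch x.2.1)) =
                          toss' (VoteCoin v (b_epoch x.2.1))) ->
  receive_proposal pr byz toss s x l = receive_proposal pr byz toss' s x l.
Proof. by case: x => B c tt'; rewrite /receive_proposal (valid_cert_agree _ tt'). Qed.

Lemma to_sample_agree toss toss' p r e m :
  (forall q, toss (SampleCoin p r q) = toss' (SampleCoin p r q)) ->
  to_sample pr toss p r e m = to_sample pr toss' p r e m.
Proof.
by move=> tt'; rewrite /to_sample; congr map; apply: eq_filter => q; rewrite tt'.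
Qed.

(** One transition reads finitely many coins, with a bound depending on [s] and [a]. The bound
    serves [trace_determined]; the restriction to [readable] coins serves [trace_upd]. *)
Lemma step_agree s a : exists K, forall toss toss',
  (forall c, coin_time c < K -> readable a c -> toss c = toss' c) ->
  step toss s a = step toss' s a.
Proof.
case: a => [[[src dst] m]|p r txs].
  case: m => [x|v B].
    exists (b_epoch x.2.1).+1 => toss toss' tt' /=; case: ifP => // _.
    by rewrite (receive_proposal_agree (toss' := toss')) // => v vb; apply: tt' => //=; rewrite vb.
  exists (b_epoch B).+1 => toss toss' tt' /=; case: ifP => // _.
  by rewrite (vote_ok_agree (toss' := toss')) // => vb; apply: tt' => //=; rewrite vb.
pose l := s_loc s p; pose e := epoch_of r.
pose N := highest (fun c : cert n Tx Hash => b_height c.1) (genesis pr, finset.set0)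
  ([seq c <- l_certs l | has_block pr l c.1] ++ formed_certs pr l e).
(* [r] covers the sampling coins, also those of round [r.-1]; [b_epoch N.1] covers the Byzantine
   votes checked when a leader receives its own proposal; [e] covers the vote coin. *)
exists (r + (b_epoch N.1) + e).+1 => toss toss' tt' /=; case: ifP => // _.
have ttS p' r' q : r' <= r -> toss (SampleCoin p' r' q) = toss' (SampleCoin p' r' q).
  by move=> r'r; apply: tt' => //=; lia.
have ttP q : toss (PropCoin p r q) = toss' (PropCoin p r q).
  by apply: tt' => //=; lia.
have ttV : r %% 3 = 0 -> toss (VoteCoin p e) = toss' (VoteCoin p e).
  move=> r3; apply: tt' => /=; first by rewrite /e; lia.
  by rewrite eqxx orbC /= /e /epoch_of; apply/orP; left; apply/eqP; lia.
have propagateE l' : propagate toss p r l' = propagate toss' p r l'.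
  rewrite /propagate; case: (l_props l') => // x xs.
  by congr map; apply: eq_filter.
rewrite /play_round.
suff -> : match r %% 3 with
    | 1 => propose pr byz toss s p r txs (s_loc s p)
    | 2 => disseminate pr toss p r (s_loc s p)
    | _ => Defs.vote pr toss p r (s_loc s p)
    end = match r %% 3 with
    | 1 => propose pr byz toss' s p r txs (s_loc s p)
    | 2 => disseminate pr toss' p r (s_loc s p)
    | _ => Defs.vote pr toss' p r (s_loc s p)
    end.
  by case: (match r %% 3 with 1 => _ | 2 => _ | _ => _ end) => l' out;
     rewrite propagateE.
have voteE : r %% 3 = 0 ->
    Defs.vote pr toss p r (s_loc s p) = Defs.vote pr toss' p r (s_loc s p).
  by move=> r3; rewrite /Defs.vote -/e ttV.
have : r %% 3 < 3 by rewrite ltn_mod.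
case r3: (r %% 3) => [|[|[|?]]] // _; first exact: voteE.
- rewrite /propose -/e -/l -/N; case: ifP => // _.
  rewrite (receive_proposal_agree (toss' := toss')).
    by rewrite (to_sample_agree (toss' := toss')) // => q; exact: ttS.
  by move=> v vb /=; apply: tt'; rewrite /= ?vb //; lia.
- rewrite /disseminate -/e ttS ?leq_pred //; case: ifP => // _.
  by congr (_, flatten _); apply: eq_map => x; apply: to_sample_agree => q; exact: ttS.
Qed.

(** * Dependence of executions on finitely many coins *)

Section Run.
Variable A : adversary n Tx Hash.
Local Notation run := (run pr byz A).
Local Notation trace := (trace pr byz A).
Local Notation act_at := (act_at pr byz A).

Lemma runS toss t : run toss t.+1 = step toss (run toss t) (act_at toss t).
Proof. by []. Qed.

(** [undup] supplies the uniqueness required when the list is tossed by [expect]. *)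
Definition coins_below K : seq (coin n) :=
  undup (flatten [seq VoteCoin p t ::
           flatten [seq [:: SampleCoin p t q; PropCoin p t q] | q <- enum 'I_n]
         | p <- enum 'I_n, t <- iota 0 K]).

Lemma mem_coins_below K c : coin_time c < K -> c \in coins_below K.
Proof.
move=> cK; rewrite mem_undup; apply/flattenP.
pose p := coin_owner c; pose t := coin_time c.
exists (VoteCoin p t ::
  flatten [seq [:: SampleCoin p t q; PropCoin p t q] | q <- enum 'I_n]).
  apply/allpairsP; exists (p, t); split => //=; first by rewrite mem_enum.
  by rewrite mem_iota.
rewrite {}/p {}/t inE; apply/orP.
case: c cK => [p t|p t q|p t q] _; first (by left; rewrite eqxx);
  right; apply/flattenP; exists [:: SampleCoin p t q; PropCoin p t q]; rewrite ?inE ?eqxx ?orbT //;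
  by apply/mapP; exists q; rewrite ?mem_enum.
Qed.

Lemma time_coins_below K c : c \in coins_below K -> coin_time c < K.
Proof.
rewrite mem_undup => /flattenP[r /allpairsP[[p u] /= [_]]].
rewrite mem_iota /= add0n => uK ->; rewrite inE => cr.
case/predU1P: cr => [->//|/flattenP[r' /mapP[q _ ->]]].
by rewrite !inE => /orP[]/eqP->.
Qed.

(** The bound of [step_agree] varies with the current state and action, which are random. Both are
    determined by finitely many coins, so [determined_by_bounded] makes the bound uniform. *)
Lemma trace_determined t : exists K, forall toss toss',
  (forall c, coin_time c < K -> toss c = toss' c) ->
  trace toss t = trace toss' t.
Proof.
elim: t => [|t [K1 HK1]]; first by exists 0.
have [Kf HKf] := choice (fun sa : state n Tx Hash * action n Tx Hash =>
  step_agree sa.1 sa.2).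
(* The next action depends on the past states and on the Byzantine coins visible within
   [lookahead]. *)
pose L := maxn K1 (lookahead A t).
have traceL toss toss' : {in coins_below L, toss =1 toss'} ->
    trace toss t = trace toss' t.
  by move=> tt'; apply: HK1 => c cK; apply/tt'/mem_coins_below; rewrite leq_max cK.
have actL toss toss' : {in coins_below L, toss =1 toss'} ->
    act_at toss t = act_at toss' t.
  move=> tt'; rewrite /Defs.act_at (traceL _ _ tt'); congr (adv_act _ _ _).
  apply: funext => c; rewrite /byz_view; case: (boolP (coin_time c < _)) => [cK|_].
    by rewrite tt' ?mem_coins_below // leq_max cK orbT.
  by rewrite !andbF.
have det : determined_by (coins_below L)
    (fun toss => Kf (run toss t, act_at toss t)).
  by move=> toss toss' tt'; rewrite (actL _ _ tt') /Defs.run (traceL _ _ tt').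
have [M HM] := determined_by_bounded det.
exists (maxn L M) => toss toss' tt'.
have ttL : {in coins_below L, toss =1 toss'}.
  by move=> c /time_coins_below cL; apply: tt'; rewrite leq_max cL.
have tE := traceL _ _ ttL; have aE := actL _ _ ttL.
rewrite /= -/(run toss t) -/(run toss' t) -/(act_at toss t) -/(act_at toss' t).
have rE : run toss t = run toss' t by rewrite /Defs.run tE.
rewrite -tE -aE -rE; congr (_ :: _).
apply: (HKf (run toss t, act_at toss t)) => c cK _; apply: tt'.
exact: leq_trans cK (leq_trans (HM toss) (leq_maxr _ _)).
Qed.

(** * Local transitions *)

(** The guard of [vote], isolated so that candidacy can be tested without looking at the coin. *)
Definition candidate l E : option (proposal n Tx Hash) :=
  if epoch_props l E is x :: xs then
    if all (fun y => y.1 == x.1) xs then Some x else None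
  else None.

Lemma candidate_mem l E x : candidate l E = Some x ->
  x \in l_props l /\ b_epoch x.1 = E.
Proof.
rewrite /candidate; case Ex: (epoch_props l E) => [|y ys] //.
case: ifP => // _ [<-]; have : y \in epoch_props l E by rewrite Ex mem_head.
by rewrite mem_filter => /andP[/eqP-> ->].
Qed.

(** Of the conditions for voting, [VoteCast] keeps the two that the counting uses: heads, and a
    height above all earlier locks. *)
Variant vote_spec toss p E l l' : Prop :=
  | VoteIdle of candidate l E = None & l_locks l' = l_locks l & l_cast l' = l_cast l
  | VoteCand x of candidate l E = Some x & l_locks l' = x.2.1 :: l_locks l
      & l_cast l' = l_cast l
  | VoteCast x of candidate l E = Some x & l_locks l' = x.2.1 :: l_locks l
      & l_cast l' = x.1 :: l_cast l & toss (VoteCoin p E)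
      & all (fun L => b_height L < b_height x.1) (l_locks l).

Arguments VoteCand {toss p E l l'} x.
Arguments VoteCast {toss p E l l'} x.

Lemma voteP toss p E l (l' := (Defs.vote pr toss p (3 * E) l).1) :
  [/\ l_props l' = l_props l, l_certs l' = l_certs l & vote_spec toss p E l l'].
Proof.
rewrite {}/l' /Defs.vote epoch_of_vote.
case Ex: (epoch_props l E) => [|x xs].
  by split => //; apply: VoteIdle => //; rewrite /candidate Ex.
case allx: (all (fun y => y.1 == x.1) xs); last first.
  by split => //; apply: VoteIdle => //; rewrite /candidate Ex allx.
case: ifP => [/and4P[heads _ _ /andP[_ locked]]|_]; split => //=.
  by apply: (VoteCast x); rewrite // /candidate Ex allx.
by apply: (VoteCand x); rewrite // /candidate Ex allx.
Qed.

(** The premise of [StepIdle] allows only stale rounds to be ignored; [step_round] and [step_lock]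
    use it to know that a newer round is really executed. *)
Variant local_step toss s a p : local n Tx Hash -> Prop :=
  | StepIdle of (forall r txs, a = Round Hash p r txs -> p \notin byz ->
        r <= l_round (s_loc s p)) : local_step toss s a p (s_loc s p)
  | StepReceive m of a = Deliver (m.1, p, m.2) :
      local_step toss s a p (receive pr byz toss s m.2 (s_loc s p))
  | StepRound r txs of a = Round Hash p r txs & p \notin byz
      & l_round (s_loc s p) < r :
      local_step toss s a p (play_round pr byz toss s p r txs (s_loc s p)).1.

Lemma stepP toss s a p : local_step toss s a p (s_loc (step toss s a) p).
Proof.
case: a => [[[src dst] m]|q r txs] /=.
  case: ifP => [/andP[_ _]|_]; last exact: StepIdle.
  rewrite /set_local ffunE; case: eqP => [->|_]; last exact: StepIdle.
  exact: (@StepReceive _ _ _ _ (src, m)).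
case: ifP => [/andP[qc lr]|].
  case play: play_round => [l out]; rewrite ffunE; case: eqP => [->|/eqP npq].
    by rewrite -[l]/((l, out).1) -play; apply: StepRound.
  by apply: StepIdle => ? ? [qp]; rewrite qp eqxx in npq.
move=> /negbT; rewrite negb_and -leqNgt => qr; apply: StepIdle => r' txs' [qp <- _] qc.
by case/orP: qr; rewrite qp // qc.
Qed.

Variant round_spec toss s p r l l' : Prop :=
  | RoundOther of r %% 3 != 0 & l_locks l' = l_locks l & l_cast l' = l_cast l
  | RoundVote E of r = 3 * E & vote_spec toss p E l l'.

Lemma receive_proposalP toss s x l (l' := receive_proposal pr byz toss s x l) :
  [/\ l_round l' = l_round l, l_locks l' = l_locks l, l_cast l' = l_cast l,
      forall y, y \in l_props l' -> y \in l_props l \/ extends pr y.2.1 y.1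
    & forall c, c \in l_certs l' -> c \in l_certs l \/ valid_cert toss s c].
Proof.
rewrite {}/l'; case: x => B c /=; case: ifP => [_|/negbFE vc].
  by split => // y; left.
split => //= [y|c'].
  case: ifP => [/andP[/and3P[_ _ ext] _]|_]; last by left.
  by rewrite mem_rcons inE => /predU1P[->|]; [right|left].
case: ifP => [_|_]; first by left.
by rewrite mem_rcons inE => /predU1P[->|]; [right|left].
Qed.

Lemma play_roundP toss s p r txs l (l' := (play_round pr byz toss s p r txs l).1) :
  [/\ l_round l' = r, round_spec toss s p r l l',
      forall y, y \in l_props l' -> y \in l_props l \/ extends pr y.2.1 y.1
    & forall c, c \in l_certs l' -> c \in l_certs l \/ valid_cert toss s c].
Proof.
rewrite {}/l' /play_round.
have : r %% 3 < 3 by rewrite ltn_mod.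
case r3: (r %% 3) => [|[|[|?]]] // _.
- have [E rE] : exists E, r = 3 * E by exists (r %/ 3); lia.
  subst r; case: (voteP toss p E l); case: vote => l1 out /= <- <- voted.
  split => //=; [|by left|by left].
  by apply: (@RoundVote _ _ _ _ _ _ E) => //; case: voted => [*|x *|x *];
    [exact: VoteIdle|exact: (VoteCand x)|exact: (VoteCast x)].
- rewrite /propose; case: ifP => _ /=; last first.
    by split => //=; [apply: RoundOther; rewrite ?r3|left|left].
  set x : proposal n Tx Hash := (Block _ _ _ _, _).
  have [_ /= lk ct pp cc] := receive_proposalP toss s x l.
  by split => //=; apply: RoundOther; rewrite ?r3.
- rewrite /disseminate; case: ifP => _ /=;
    by split => //=; [apply: RoundOther; rewrite ?r3|left|left].
Qed.

Lemma receiveP toss s m l (l' := receive pr byz toss s m l) :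
  [/\ l_round l' = l_round l, l_locks l' = l_locks l, l_cast l' = l_cast l,
      forall y, y \in l_props l' -> y \in l_props l \/ extends pr y.2.1 y.1
    & forall c, c \in l_certs l' -> c \in l_certs l \/ valid_cert toss s c].
Proof.
rewrite {}/l'; case: m => [x|v B] /=; first exact: receive_proposalP.
by case: ifP => _; split => // y; left.
Qed.

Lemma step_props toss s a p y : y \in l_props (s_loc (step toss s a) p) ->
  y \in l_props (s_loc s p) \/ extends pr y.2.1 y.1.
Proof.
case: stepP => [_|m _|r txs _ _ _]; first by left.
  by case: (receiveP toss s m.2 (s_loc s p)) => _ _ _ + _; apply.
by case: (play_roundP toss s p r txs (s_loc s p)) => _ _ + _; apply.
Qed.

Lemma step_certs toss s a p c : c \in l_certs (s_loc (step toss s a) p) ->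
  c \in l_certs (s_loc s p) \/ valid_cert toss s c.
Proof.
case: stepP => [_|m _|r txs _ _ _]; first by left.
  by case: (receiveP toss s m.2 (s_loc s p)) => _ _ _ _; apply.
by case: (play_roundP toss s p r txs (s_loc s p)) => _ _ _; apply.
Qed.

Lemma step_round_le toss s a p :
  l_round (s_loc s p) <= l_round (s_loc (step toss s a) p).
Proof.
case: stepP => [_|m _|r txs _ _ lr] //.
  by case: (receiveP toss s m.2 (s_loc s p)) => ->.
by case: (play_roundP toss s p r txs (s_loc s p)) => ->; rewrite ltnW.
Qed.

Lemma step_round toss s p r txs : p \notin byz -> l_round (s_loc s p) < r ->
  l_round (s_loc (step toss s (Round Hash p r txs)) p) = r.
Proof.
move=> pc lr; case: stepP => [/(_ _ _ erefl pc)|m //|r' txs' [<- <-] _ _].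
  by rewrite leqNgt lr.
by case: (play_roundP toss s p r txs (s_loc s p)) => ->.
Qed.

Lemma step_locks toss s a p L : L \in l_locks (s_loc s p) ->
  L \in l_locks (s_loc (step toss s a) p).
Proof.
move=> Ll; case: stepP => [_|m _|r txs _ _ _] //.
  by case: (receiveP toss s m.2 (s_loc s p)) => _ ->.
case: (play_roundP toss s p r txs (s_loc s p)) => _ [_ ->//|E _] [_ ->//|x _ ->|x _ ->] *;
  by rewrite inE Ll orbT.
Qed.

Lemma step_lock toss s p E txs x : p \notin byz -> l_round (s_loc s p) < 3 * E ->
  candidate (s_loc s p) E = Some x ->
  x.2.1 \in l_locks (s_loc (step toss s (Round Hash p (3 * E) txs)) p).
Proof.
move=> pc lr cx; case: stepP => [/(_ _ _ erefl pc)|m //|r' txs' [<- <-] _ _].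
  by rewrite leqNgt lr.
case: (play_roundP toss s p (3 * E) txs (s_loc s p)) => _.
case=> [|E' EE' sp]; first by rewrite modnMr.
have {EE'} EE' : E = E' by lia.
subst E'; case: sp => [|y|y]; rewrite cx // => -[<-] -> *; exact: mem_head.
Qed.

Lemma step_cast toss s a p B : B \in l_cast (s_loc s p) ->
  B \in l_cast (s_loc (step toss s a) p).
Proof.
move=> Ll; case: stepP => [_|m _|r txs _ _ _] //.
  by case: (receiveP toss s m.2 (s_loc s p)) => _ _ ->.
case: (play_roundP toss s p r txs (s_loc s p)) => _ [_ _ ->//|E _].
by case=> [_ _ ->//|x _ _ ->//|x _ _ ->] *; rewrite inE Ll orbT.
Qed.

Lemma step_cast_new toss s a p B : B \in l_cast (s_loc (step toss s a) p) ->
  B \in l_cast (s_loc s p) \/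
  exists E txs x,
    [/\ a = Round Hash p (3 * E) txs, p \notin byz, l_round (s_loc s p) < 3 * E,
        candidate (s_loc s p) E = Some x
      & [/\ B = x.1, toss (VoteCoin p E)
          & all (fun L => b_height L < b_height x.1) (l_locks (s_loc s p))]].
Proof.
case: stepP => [_|m _|r txs -> pc lr]; first by left.
  by case: (receiveP toss s m.2 (s_loc s p)) => _ _ -> _ _; left.
case: (play_roundP toss s p r txs (s_loc s p)) => _ [_ _ ->|E rE]; first by left.
subst r.
case=> [_ _ ->|x _ _ ->|x cx _ -> heads locked]; [by left|by left|].
move=> _ _; rewrite inE => /predU1P[->|]; last by left.
by right; exists E, txs, x.
Qed.


(** * Invariants of executions *)

Lemma run_round_le toss t p :
  l_round (s_loc (run toss t) p) <= l_round (s_loc (run toss t.+1) p).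
Proof. by rewrite runS; exact: step_round_le. Qed.

Lemma run_props toss t p x :
  x \in l_props (s_loc (run toss t) p) -> extends pr x.2.1 x.1.
Proof.
elim: t => [|t IHt]; first by rewrite /= ffunE.
by rewrite runS => /step_props[/IHt|].
Qed.

Lemma run_candidate_height toss t p E (x : proposal n Tx Hash) :
  candidate (s_loc (run toss t) p) E = Some x ->
  b_height x.1 = (b_height x.2.1).+1.
Proof. by case/candidate_mem => /run_props/andP[_ /eqP]. Qed.

Lemma valid_cert_step toss t c : valid_cert toss (run toss t) c ->
  valid_cert toss (run toss t.+1) c.
Proof.
rewrite /Defs.valid_cert => /orP[->//|/andP[-> /forallP vc]].
rewrite orbC; apply/orP; left; apply/forallP => v; apply/implyP => vc2.
have := implyP (vc v) vc2; rewrite /Defs.vote_ok; case: ifP => // _.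
by rewrite runS; exact: step_cast.
Qed.

(** A certificate is checked on reception and cast votes are never withdrawn. This lets certificates
    seen at different ticks be evaluated at a common later one. *)
Lemma run_certs toss t t' p c : t <= t' ->
  c \in l_certs (s_loc (run toss t) p) -> valid_cert toss (run toss t') c.
Proof.
move=> tt' ct; elim: t' tt' => [|t' IHt'] tt'.
  by move: tt' ct; rewrite leqn0 => /eqP->; rewrite /= ffunE.
have [lt_tt'|ge_tt'] := leqP t t'; first exact/valid_cert_step/IHt'.
have {tt' ge_tt' IHt'} -> : t'.+1 = t by lia.
elim: t ct => [|t IHt]; first by rewrite /= ffunE.
rewrite runS => /step_certs[/IHt|]; first exact: valid_cert_step.
by move=> vc; apply: valid_cert_step.
Qed.

Lemma run_cast_spec toss t p B : B \in l_cast (s_loc (run toss t) p) ->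
  [/\ p \notin byz, 3 * b_epoch B <= l_round (s_loc (run toss t) p)
    & toss (VoteCoin p (b_epoch B))].
Proof.
elim: t => [|t IHt]; first by rewrite /= ffunE.
rewrite runS => /step_cast_new[/IHt[pc lr ->]|].
  by split => //; apply: leq_trans lr (run_round_le _ _ _).
move=> [E [txs [x [-> pc lr cx [-> heads _]]]]].
by have [_ ->] := candidate_mem cx; rewrite step_round.
Qed.

(** Each vote round is executed at most once: an earlier vote in the same epoch would already have
    raised [l_round] to that round. *)
Lemma run_cast_inj toss t p B B' : B \in l_cast (s_loc (run toss t) p) ->
  B' \in l_cast (s_loc (run toss t) p) -> b_epoch B = b_epoch B' -> B = B'.
Proof.
elim: t => [|t IHt]; first by rewrite /= ffunE.
rewrite runS => /step_cast_new[BIn|[E [txs [x [aE _ lr cx [-> _ _]]]]]];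
  move=> /step_cast_new[B'In|[E' [txs' [x' [aE' _ lr' cx' [-> _ _]]]]]].
- exact: IHt.
- have [_ ->] := candidate_mem cx'; have [_ + _] := run_cast_spec BIn.
  by move=> + BE; rewrite BE leqNgt lr'.
- have [_ ->] := candidate_mem cx; have [_ + _] := run_cast_spec B'In.
  by move=> + BE; rewrite -BE leqNgt lr.
- have [_ ->] := candidate_mem cx; have [_ ->] := candidate_mem cx'.
  by move=> EE'; move: cx'; rewrite -EE' cx => -[->].
Qed.

(** * Charged coins *)

Section Charge.
Variables (e e' h K : nat).
Hypothesis ee' : e <= e'.

Definition offset : nat := e < e'.

Lemma offsetP : offset = 0 /\ e = e' \/ offset = 1 /\ e < e'.
Proof. by rewrite /offset; case: (ltnP e e') => ?; [right|left; split=> //; lia]. Qed.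

(* [C_k] is the block of index [k + offset] of the chain starting in epoch [e], and
   [C'_k] the block of index [k] of the chain starting in epoch [e'].  When
   [e < e'], the candidates for [C_k] are locked at height [h + k], so none of them
   votes later for [C'_k]: each process is charged at most one coin for each [k]. *)
Definition matches E H (locks : seq (block Tx Hash)) (k : 'I_K) : bool :=
  (E == e + offset + k) && (H == h + offset + k) ||
  [&& E == e' + k, H == h + k & all (fun L => b_height L < H) locks].

(** The charge is made when the process becomes a candidate, whether or not it then votes; thus
    which coin is charged does not depend on its outcome. *)
Definition charge s a : option ('I_n * nat * 'I_K) :=
  if a is Round p r txs then
    let l := s_loc s p in
    if [&& p \notin byz, l_round l < r & r %% 3 == 0] then
      if candidate l (r %/ 3) is Some x then
        omap (fun k => (p, r %/ 3, k))
             [pick k | matches (r %/ 3) (b_height x.1) (l_locks l) k]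
      else None
    else None
  else None.

Definition charge_at toss t := charge (run toss t) (act_at toss t).

Fixpoint charged toss t : seq ('I_n * nat * 'I_K) :=
  if t is t'.+1 then
    if charge_at toss t' is Some c then c :: charged toss t'
    else charged toss t'
  else [::].

Definition charged_coin (c : 'I_n * nat * 'I_K) : coin n := VoteCoin c.1.1 c.1.2.

Lemma chargeP s a p E k : charge s a = Some (p, E, k) ->
  exists txs x, [/\ a = Round Hash p (3 * E) txs, p \notin byz,
    l_round (s_loc s p) < 3 * E, candidate (s_loc s p) E = Some x
    & matches E (b_height x.1) (l_locks (s_loc s p)) k].
Proof.
case: a => // q r txs /=; case: ifP => // /and3P[qc lr /eqP r3].
have [E' rE] : exists E', r = 3 * E' by exists (r %/ 3); lia.
rewrite rE mulKn //= in lr *; case cx: candidate => [x|] //.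
case: pickP => [k' mk'|] //= [qp EE' kk']; subst q E' k'.
by exists txs, x.
Qed.

Lemma charge_candidate s a p E txs x k : a = Round Hash p (3 * E) txs ->
  p \notin byz -> l_round (s_loc s p) < 3 * E -> candidate (s_loc s p) E = Some x ->
  matches E (b_height x.1) (l_locks (s_loc s p)) k ->
  exists k', charge s a = Some (p, E, k').
Proof.
move=> -> pc lr cx mk; rewrite /= pc lr modnMr mulKn //= cx.
by case: pickP => [k' _|/(_ k)]; [exists k'|rewrite mk].
Qed.

(** A candidate for a block of height [h + k + 1] is locked on its parent, of height [h + k]. The
    premise [e + offset < e'] excludes [e' = e] and [e' = e + 1], where both blocks of a pair have
    the same epoch. *)
Lemma charged_spec toss t p E k : (p, E, k) \in charged toss t ->
  [/\ p \notin byz, 3 * E <= l_round (s_loc (run toss t) p),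
      E = e + offset + k \/ E = e' + k
    & E = e + offset + k -> e + offset < e' ->
      exists2 L, L \in l_locks (s_loc (run toss t) p) & h + k <= b_height L].
Proof.
elim: t => [//|t IHt].
have old : (p, E, k) \in charged toss t ->
  [/\ p \notin byz, 3 * E <= l_round (s_loc (run toss t.+1) p),
      E = e + offset + k \/ E = e' + k
    & E = e + offset + k -> e + offset < e' ->
      exists2 L, L \in l_locks (s_loc (run toss t.+1) p) & h + k <= b_height L].
  move=> /IHt[pc lr Ek lock]; split => //; first exact: leq_trans lr (run_round_le _ _ _).
  by move=> Ek1 ltee'; have [L Lin hL] := lock Ek1 ltee'; exists L => //; exact: step_locks.
rewrite [charged _ _]/=; case ct: charge_at => [c|] //.
rewrite inE => /predU1P[ck|//]; rewrite -ck in ct.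
have [txs [x [aE pc lr cx mk]]] := chargeP ct.
rewrite runS aE step_round //; split => //.
  by case/orP: mk => [/andP[/eqP-> _]|/and3P[/eqP-> _ _]]; [left|right].
move=> Ek ltee'; exists x.2.1; first exact: step_lock.
have hx := run_candidate_height cx.
by case/orP: mk => [/andP[_ /eqP]|/and3P[/eqP]]; have := offsetP; lia.
Qed.

(** Rounds increase, hence [E' < E]. With equal indices the old charge would be for the first block
    of the pair and the new one for the second; but the lock left by the former has height at least
    [h + k], which [matches] forbids. *)
Lemma charge_at_fresh toss t p E E' k k' : charge_at toss t = Some (p, E, k) ->
  (p, E', k') \in charged toss t -> E' < E /\ k' != k.
Proof.
move=> /chargeP[txs [x [aE pc lr cx mk]]] /charged_spec[_ lr' Ek' lock].
have EE' : E' < E by lia.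
split => //; apply/eqP => kk'; subst k'.
have Ek : E = e' + k.
  case/orP: mk => [/andP[/eqP Ek _]|/and3P[/eqP-> //]].
  by case: Ek' => Ek'; move: EE'; have := offsetP; lia.
have {}Ek' : E' = e + offset + k by case: Ek' => //; lia.
have [|L Lin hL] := lock Ek'; first by lia.
case/orP: mk => [/andP[/eqP]|/and3P[_ /eqP-> /allP/(_ _ Lin)]]; first by lia.
by rewrite ltnNge hL.
Qed.

Lemma charged_coin_fresh toss t c c' : charge_at toss t = Some c ->
  c' \in charged toss t -> charged_coin c' != charged_coin c.
Proof.
case: c c' => [[p E] k] [[p' E'] k'] ct c't.
apply/eqP => -[pp' EE']; subst p' E'.
by have [] := charge_at_fresh ct c't; rewrite ltnn.
Qed.

(** By [charge_at_fresh], charges have distinct pairs of a correct process and an index below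
    [K]. *)
Lemma size_charged toss t : size (charged toss t) <= K * (n - #|byz|).
Proof.
pose pk (c : 'I_n * nat * 'I_K) := (c.1.1, c.2).
have uniq_pk : uniq (map pk (charged toss t)).
  elim: t => [//|t IHt] /=; case ct: charge_at => [[[p E] k]|] //=.
  rewrite IHt andbT; apply/mapP => -[[[p' E'] k'] c't [pp' kk']]; subst p' k'.
  by have [_] := charge_at_fresh ct c't; rewrite eqxx.
rewrite -(size_map pk).
apply: leq_trans (uniq_leq_size uniq_pk (s2 := enum (finset.setX (~: byz) [set: 'I_K])) _) _.
  move=> _ /mapP[[[p E] k] /charged_spec[pc _ _ _] ->].
  by rewrite mem_enum !inE pc.
by rewrite -cardE cardsX cardsCs finset.setCK cardsT !card_ord mulnC.
Qed.

(** A voter has passed the lock test that [matches] demands for second blocks. The index returned by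
    [pick] may differ from [k], hence the existential. *)
Lemma cast_charged toss t p B k : B \in l_cast (s_loc (run toss t) p) ->
  (b_epoch B = e + offset + k /\ b_height B = h + offset + k) \/
  (b_epoch B = e' + k /\ b_height B = h + k) -> k < K ->
  exists k', (p, b_epoch B, k') \in charged toss t.
Proof.
move=> + Bk kK; elim: t => [|t IHt]; first by rewrite /= ffunE.
rewrite runS => /step_cast_new[/IHt[k' ck']|].
  by exists k'; rewrite /=; case: charge_at => [c|] //; rewrite inE ck' orbT.
move=> [E [txs [x [aE pc lr cx [Bx _ locked]]]]]; subst B.
have EE := (candidate_mem cx).2; rewrite EE.
have mk : matches E (b_height x.1) (l_locks (s_loc (run toss t) p)) (Ordinal kK).
  rewrite /matches /= -EE.
  by case: Bk => -[-> hx]; rewrite locked hx !eqxx ?orbT.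
have [k' ck'] := charge_candidate aE pc lr cx mk.
by exists k'; rewrite /= /charge_at ck' mem_head.
Qed.

Lemma charged_epoch toss t p E k : (p, E, k) \in charged toss t -> E <= e' + K.
Proof.
move=> /charged_spec[_ _ Ek _]; have := ltn_ord k.
by have := offsetP; lia.
Qed.

(** * Vote coins are unbiased when they are charged *)

(** Beyond the past states, the adversary sees coins only through [byz_view], which hides those of
    correct processes. *)
Lemma act_at_upd toss t p E y : p \notin byz ->
  trace (upd toss (VoteCoin p E) y) t = trace toss t ->
  act_at (upd toss (VoteCoin p E) y) t = act_at toss t.
Proof.
move=> pc tE; rewrite /Defs.act_at tE; congr adv_act.
apply: funext => c; rewrite /byz_view; case: (boolP (coin_owner c \in byz)) => //= cb.
by rewrite upd_other //; apply: contraNneq pc => cE; rewrite cE in cb.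
Qed.

(** Only round [3 * E] of [p] reads this coin, and the bound on [l_round] shows that it has not been
    executed yet. *)
Lemma trace_upd toss t p E y : p \notin byz ->
  l_round (s_loc (run toss t) p) < 3 * E ->
  trace (upd toss (VoteCoin p E) y) t = trace toss t /\
  charged (upd toss (VoteCoin p E) y) t = charged toss t.
Proof.
move=> pc; elim: t => [//|t IHt] lr.
have {IHt}[tE cE] := IHt (leq_ltn_trans (run_round_le _ _ _) lr).
have aE := act_at_upd pc tE.
have rE : run (upd toss (VoteCoin p E) y) t = run toss t by rewrite /Defs.run tE.
split; last by rewrite /= /charge_at aE rE cE.
rewrite /= -/(run _ t) -/(run toss t) -/(act_at _ t) -/(act_at toss t) aE rE tE.
congr (_ :: _); have [M HM] := step_agree (run toss t) (act_at toss t).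
apply: HM => c _ rc; rewrite upd_other //; apply: contraTneq rc => ->.
rewrite /= (negbTE pc) /=; case aT: (act_at toss t) => [//|q r txs].
apply/negP => /andP[/eqP qp /eqP rE3]; subst q r.
move: lr; rewrite runS aT; case: (ltnP (l_round (s_loc (run toss t) p)) (3 * E)).
  by move=> lr; rewrite step_round // ltnn.
by move=> lr; rewrite ltnNge (leq_trans lr (step_round_le _ _ _ _)).
Qed.

(** The invariance that [expect_step] asks for: the charge precedes the reading of the coin. *)
Lemma charge_at_upd toss t c y : charge_at toss t = Some c ->
  charge_at (upd toss (charged_coin c) y) t = Some c /\
  charged (upd toss (charged_coin c) y) t = charged toss t.
Proof.
case: c => [[p E] k] ct; have [txs [x [aE pc lr cx mk]]] := chargeP ct.
have [tE ->] := trace_upd y pc lr; split=> //.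
by rewrite /charge_at /charged_coin act_at_upd // /Defs.run tE.
Qed.

(** * Conflicting chains *)

Definition certified_by toss t B (V : {set 'I_n}) : Prop :=
  quorum pr <= #|V| /\ forall v, v \in V -> vote_ok toss (run toss t) v B.

(** For [K = kappa - 1] the indices up to [K] cover all [kappa] blocks; the last one leaves room for
    the shift by [offset]. *)
Definition chain_at toss t (e0 : nat) (b : nat -> block Tx Hash) : Prop :=
  forall k, k <= K -> [/\ b_epoch (b k) = e0 + k, b_height (b k) = h + k
    & exists V, certified_by toss t (b k) V].

Definition byz_coins (e0 : nat) : seq (coin n) :=
  [seq VoteCoin v (e0 + k) | v <- enum byz, k <- iota 0 K].

Definition ballots (e0 : nat) (V : nat -> {set 'I_n}) : seq (coin n) :=
  [seq VoteCoin v (e0 + k) | k <- iota 0 K, v <- enum (V k)].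

Lemma uniq_byz_coins e0 : uniq (byz_coins e0).
Proof.
apply: allpairs_uniq; rewrite ?enum_uniq ?iota_uniq //.
by move=> [v k] [v' k'] _ _ [-> /addnI->].
Qed.

Lemma size_byz_coins e0 : size (byz_coins e0) = K * #|byz|.
Proof. by rewrite size_allpairs size_iota -cardE mulnC. Qed.

Lemma mem_byz_coins e0 c : c \in byz_coins e0 ->
  exists v k, [/\ c = VoteCoin v (e0 + k), v \in byz & k < K].
Proof.
move=> /allpairsP[[v k] /= [vb kK ->]]; exists v, k.
by rewrite mem_enum in vb; rewrite mem_iota in kK.
Qed.

Lemma uniq_ballots e0 (V : nat -> {set 'I_n}) : uniq (ballots e0 V).
Proof.
apply: allpairs_uniq_dep; rewrite ?iota_uniq //; first by move=> ? _; exact: enum_uniq.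
by move=> [k v] [k' v'] _ _ /= [-> /addnI->].
Qed.

Lemma ballotsP e0 (V : nat -> {set 'I_n}) c :
  reflect (exists v k, [/\ c = VoteCoin v (e0 + k), v \in V k & k < K])
  (c \in ballots e0 V).
Proof.
apply: (iffP allpairsPdep) => [[k [v [kK vV ->]]]|[v [k [-> vV kK]]]].
  by exists v, k; rewrite mem_enum in vV; rewrite mem_iota in kK.
by exists k, v; rewrite mem_iota mem_enum.
Qed.

Lemma size_ballots e0 (V : nat -> {set 'I_n}) : (forall k, k < K -> quorum pr <= #|V k|) ->
  K * quorum pr <= size (ballots e0 V).
Proof.
move=> qV; rewrite size_allpairs_dep.
have {qV} : forall k, k \in iota 0 K -> quorum pr <= #|V k|.
  by move=> k; rewrite mem_iota => kK; exact: qV.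
rewrite -[X in X * _](size_iota 0 K); elim: (iota 0 K) => [//|k r IHr] qV /=.
rewrite mulSn leq_add // -?cardE ?qV ?mem_head // IHr // => k' k'r.
by apply: qV; rewrite inE k'r orbT.
Qed.

Lemma size_split (r : seq (coin n)) :
  size r = count (fun c => coin_owner c \in byz) r +
           count (fun c => coin_owner c \notin byz) r.
Proof. by rewrite count_predC. Qed.

Lemma count_byz_ballots toss t e0 b (V : nat -> {set 'I_n}) :
  (forall k, k < K -> b_epoch (b k) = e0 + k /\ certified_by toss t (b k) (V k)) ->
  count (fun c => coin_owner c \in byz) (ballots e0 V) <= count toss (byz_coins e0).
Proof.
move=> bV; rewrite -!size_filter; apply: uniq_leq_size.
  by rewrite filter_uniq // uniq_ballots.
move=> c; rewrite !mem_filter => /andP[cb /ballotsP[v [k [cE vV kK]]]].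
subst c; rewrite /= in cb.
have [be [_ /(_ _ vV)]] := bV k kK; rewrite /Defs.vote_ok cb be => heads; apply/andP; split=> //.
by apply: allpairs_f; rewrite ?mem_enum ?mem_iota.
Qed.

(** The [2 * K] paired blocks need [2 * K * quorum] votes. Byzantine votes show heads among
    [byz_coins]; the votes of correct processes use pairwise distinct coins, all charged and all
    heads. *)
Lemma conflict_count toss t b b' :
  chain_at toss t e b -> chain_at toss t e' b' ->
  (forall k, k <= K -> b k <> b' k) ->
  2 * K * quorum pr <= count toss (byz_coins (e + offset)) + count toss (byz_coins e')
                       + count toss (map charged_coin (charged toss t)).
Proof.
move=> cb cb' bb'.
have /choice[V HV] : forall k, exists V, k <= K -> certified_by toss t (b k) V.
  move=> k; case: (leqP k K) => kK; last by exists finset.set0.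
  by have [_ _ [V HV]] := cb k kK; exists V.
have /choice[V' HV'] : forall k, exists V, k <= K -> certified_by toss t (b' k) V.
  move=> k; case: (leqP k K) => kK; last by exists finset.set0.
  by have [_ _ [V' HV']] := cb' k kK; exists V'.
pose c_ k := b (offset + k); pose U k := V (offset + k).
have offsetK k : k < K -> offset + k <= K by have := offsetP; lia.
have cU k : k < K -> b_epoch (c_ k) = e + offset + k /\ certified_by toss t (c_ k) (U k).
  by move=> kK; have [-> _ _] := cb _ (offsetK _ kK); rewrite addnA; split=> //; exact/HV/offsetK.
have cV' k : k < K -> b_epoch (b' k) = e' + k /\ certified_by toss t (b' k) (V' k).
  by move=> kK; have [-> _ _] := cb' _ (ltnW kK); split=> //; exact/HV'/ltnW.
have := count_byz_ballots cU; have := count_byz_ballots cV'.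
have := size_ballots (e + offset) (fun k kK => (cU k kK).2.1).
have := size_ballots e' (fun k kK => (cV' k kK).2.1).
rewrite !size_split.
set corr := fun c => coin_owner c \notin byz.
suff : count corr (ballots (e + offset) U) + count corr (ballots e' V') <=
    count toss [seq charged_coin i | i <- charged toss t].
  rewrite -mulnA /corr.
  move: (K * quorum pr) (count _ (ballots _ U)) (count _ (ballots _ V')).
  move: (count _ (ballots _ U)) (count _ (ballots _ V')) (count toss _).
  lia.
rewrite -!size_filter -size_cat; apply: uniq_leq_size.
  rewrite cat_uniq !filter_uniq ?uniq_ballots //= andbT.
  apply/hasPn => c; rewrite !mem_filter => /andP[cc /ballotsP[v [k [cE vV kK]]]].
  rewrite cc /=; apply/ballotsP => -[v' [k' [cE' vV' kK']]]; subst c.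
  case: cE' => vv' Ekk'; subst v'; rewrite /corr /= in cc.
  have [be [_ /(_ _ vV)]] := cV' k kK; have [be' [_ /(_ _ vV')]] := cU k' kK'.
  rewrite /Defs.vote_ok (negbTE cc) => cast cast'.
  (* A coin used for both chains means one process voting in one epoch, hence for one block.
     Comparing heights then puts this block at the same index of both chains, against [bb']. *)
  have cb'E : c_ k' = b' k by apply: run_cast_inj cast cast' _; rewrite be be'.
  have [_ hb _] := cb _ (offsetK _ kK'); have [_ hb' _] := cb' _ (ltnW kK).
  have offsetkk' : offset + k' = k.
    by move: hb hb'; rewrite -/(c_ k') cb'E => ->; lia.
  by apply: (bb' k (ltnW kK)); rewrite -cb'E /c_ offsetkk'.
have charged_heads v B k : v \notin byz -> vote_ok toss (run toss t) v B ->
    (b_epoch B = e + offset + k /\ b_height B = h + offset + k) \/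
    (b_epoch B = e' + k /\ b_height B = h + k) -> k < K ->
    VoteCoin v (b_epoch B) \in
      [seq x <- [seq charged_coin i | i <- charged toss t] | toss x].
  rewrite /Defs.vote_ok => vb; rewrite (negbTE vb) => cast Bk kK.
  have [_ _ heads] := run_cast_spec cast.
  have [k' ck'] := cast_charged cast Bk kK.
  by rewrite mem_filter heads; apply/mapP; exists (v, b_epoch B, k').
move=> c; rewrite mem_cat !(mem_filter corr).
case/orP => /andP[cc /ballotsP[v [k [cE vV kK]]]]; subst c.
- have [be [_ /(_ _ vV) ok]] := cU k kK.
  rewrite -be; apply: (charged_heads _ _ k) => //; left; split=> //.
  by have [_ -> _] := cb _ (offsetK _ kK); rewrite addnA.
- have [be [_ /(_ _ vV) ok]] := cV' k kK.
  rewrite -be; apply: (charged_heads _ _ k) => //; right; split=> //.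
  by have [_ -> _] := cb' _ (ltnW kK).
Qed.

End Charge.
End Run.
End Protocol.

(** * Safety violations as pairs of conflicting chains *)

Section Violation.
Local Open Scope nat_scope.
Variables (n : nat) (Tx Hash : eqType).
Variables (pr : protocol n Tx Hash) (byz : {set 'I_n}) (A : adversary n Tx Hash).
Implicit Types (toss : coin n -> bool) (B : block Tx Hash) (p : 'I_n).
Local Notation run := (run pr byz A).
Local Notation trace := (trace pr byz A).

Definition violation_at toss (h e e' t t' : nat) : Prop :=
  exists (i j : 'I_n) (anc pre : seq (block Tx Hash)) (B1 : block Tx Hash)
         (bs anc' : seq (block Tx Hash)) (B1' : block Tx Hash)
         (bs' : seq (block Tx Hash)),
  [/\ [/\ i \notin byz, j \notin byz & i != j],
      commits_through pr (s_loc (run toss t) i) (anc ++ pre) B1 bs,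
      committed_before pr byz A toss i t (last (genesis pr) anc) /\
      (forall B, committed_before pr byz A toss i t B ->
         b_height B <= b_height (last (genesis pr) anc)),
      commits_through pr (s_loc (run toss t') j) anc' B1' bs'
    & [/\ b_txs B1 != b_txs B1', b_height B1 = h, b_height B1' = h,
          b_epoch B1 = e & b_epoch B1' = e']].

(** Bounding both commit ticks gives an event that depends on finitely many coins and grows with
    [u]. *)
Definition violation_by toss h e e' (u : nat) : Prop :=
  exists t t', [/\ t <= u, t' <= u & violation_at toss h e e' t t'].

Lemma safety_violationE toss h e e' :
  safety_violation pr byz A toss h e e' <-> exists u, violation_by toss h e e' u.
Proof.
split=> [[i [j [t [t' V]]]]|[u [t [t' [_ _ [i [j V]]]]]]].
  exists (t + t'), t, t'; rewrite leq_addr leq_addl; split => //.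
  by exists i, j.
by exists i, j, t, t'.
Qed.

Lemma trace_le toss toss' t u : t <= u -> trace toss u = trace toss' u ->
  run toss t = run toss' t.
Proof.
move=> tu tE; suff : trace toss t = trace toss' t by rewrite /Defs.run => ->.
elim: u tu tE => [|u IHu]; first by rewrite leqn0 => /eqP->.
by rewrite leq_eqVlt => /predU1P[->//|tu] /= [_ /IHu]; apply.
Qed.

Lemma committed_before_run toss toss' t p B :
  (forall u, u <= t -> run toss u = run toss' u) ->
  committed_before pr byz A toss p t B -> committed_before pr byz A toss' p t B.
Proof.
move=> tt' [->|[t0 [anc [B1 [bs [t0t cB BB]]]]]]; [by left|right].
by exists t0, anc, B1, bs; rewrite -tt' // ltnW.
Qed.

Lemma violation_by_run toss toss' h e e' u : trace toss u = trace toss' u ->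
  violation_by toss h e e' u -> violation_by toss' h e e' u.
Proof.
move=> tE [t [t' [tu t'u]]].
move=> [i [j [anc [pre [B1 [bs [anc' [B1' [bs' [ij c1 [cb mx] c2 BB]]]]]]]]]].
exists t, t'; split => //; exists i, j, anc, pre, B1, bs, anc', B1', bs'.
have rE v : v <= u -> run toss v = run toss' v by move=> vu; exact: trace_le tE.
have rEt v : v <= t -> run toss v = run toss' v by move=> vt; exact/rE/(leq_trans vt).
rewrite -!rE //; split => //; split; first exact: committed_before_run cb.
by move=> B cB; apply/mx/(committed_before_run _ cB) => v vt; rewrite rEt.
Qed.

Lemma violation_by_determined h e e' u : exists M, determined_by (coins_below n M)
  (fun toss => violation_by toss h e e' u).
Proof.
have [M HM] := trace_determined pr byz A u; exists M => toss toss' tt'.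
have tE : trace toss u = trace toss' u by apply: HM => c /mem_coins_below/tt'.
by apply: propext; split; apply: violation_by_run.
Qed.

Hypotheses (hash_inj : injective (hash pr)) (genesis_height : b_height (genesis pr) = 0).

Lemma commits_chain toss t u i anc B1 bs : t <= u ->
  commits_through pr (s_loc (run toss t) i) anc B1 bs ->
  chain_at pr byz A (b_height B1) (kappa pr).-1 toss u (b_epoch B1)
    (nth (genesis pr) (B1 :: bs)).
Proof.
move=> tu [pathB certB sizeB epochB _] k kK.
have kbs : k <= size bs by rewrite -sizeB in kK.
move: pathB; rewrite cat_path /= => /and3P[_ extB1 pathB].
have epochk : b_epoch (nth (genesis pr) (B1 :: bs) k) = b_epoch B1 + k.
  elim: k {kK} kbs => [|k IHk] kbs; first by rewrite addn0.
  by have /eqP -> := pathP (genesis pr) epochB k kbs; rewrite IHk ?addnS // ltnW.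
have heightk : b_height (nth (genesis pr) (B1 :: bs) k) = b_height B1 + k.
  elim: k {kK epochk} kbs => [|k IHk] kbs; first by rewrite addn0.
  have /andP[_ /eqP ->] := pathP (genesis pr) pathB k kbs.
  by rewrite IHk ?addnS // ltnW.
split => //.
have : nth (genesis pr) (B1 :: bs) k \in certified pr (s_loc (run toss t) i).
  by apply: (allP certB); rewrite mem_cat mem_nth ?orbT.
(* Positive height excludes the genesis block, which [valid_cert] accepts without a quorum. *)
have nG : nth (genesis pr) (B1 :: bs) k <> genesis pr.
  move=> kG; move: heightk; rewrite kG genesis_height.
  by have /andP[_ /eqP ->] := extB1.
rewrite inE => /predU1P[//|/mapP[c]]; rewrite mem_filter => /andP[_ ci] cE.
have := run_certs tu ci; rewrite /valid_cert -cE => /orP[/eqP//|/andP[qV /forallP okV]].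
by exists c.2; split => // v; exact/implyP.
Qed.

(** Equal blocks have equal parent hashes, so by [hash_inj] equality would descend to the first
    blocks, whose payloads differ. *)
Lemma conflicting_chains_neq B B' bs bs' k : b_txs B != b_txs B' ->
  path (extends pr) B bs -> path (extends pr) B' bs' ->
  k <= size bs -> k <= size bs' ->
  nth (genesis pr) (B :: bs) k <> nth (genesis pr) (B' :: bs') k.
Proof.
move=> txsB pB pB'; elim: k => [_ _ BB'|k IHk kb kb' BB'] /=.
  by move: txsB; rewrite -[B]/(nth (genesis pr) (B :: bs) 0) BB' eqxx.
apply: IHk; [exact: ltnW|exact: ltnW|apply: hash_inj].
have /andP[/eqP <- _] := pathP (genesis pr) pB k kb.
by have /andP[/eqP <- _] := pathP (genesis pr) pB' k kb'; congr b_parent.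
Qed.

Lemma violation_chains toss h e e' u : violation_by toss h e e' u ->
  exists b b', [/\ chain_at pr byz A h (kappa pr).-1 toss u e b,
    chain_at pr byz A h (kappa pr).-1 toss u e' b'
    & forall k, k <= (kappa pr).-1 -> b k <> b' k].
Proof.
move=> [t [t' [tu t'u]]].
move=> [i [j [anc [pre [B1 [bs [anc' [B1' [bs' [_ c1 _ c2]]]]]]]]]].
case=> txsB hB hB' <- <-.
exists (nth (genesis pr) (B1 :: bs)), (nth (genesis pr) (B1' :: bs')); split.
- by rewrite -hB; exact: commits_chain tu c1.
- by rewrite -hB'; exact: commits_chain t'u c2.
case: c1 c2 => p1 _ s1 _ _ [p2 _ s2 _ _] k kK.
move: p1 p2; rewrite !cat_path /= => /and3P[_ _ p1] /and3P[_ _ p2].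
rewrite /= in s1 s2; rewrite -s1 /= in s2 kK.
by apply: conflicting_chains_neq => //; lia.
Qed.

(** The roles of the two processes in a violation differ, but the vote count is symmetric in the
    chains; covering both orders allows the epochs to be sorted. *)
Lemma violation_count toss h e e' u (K := (kappa pr).-1) : e <= e' ->
  violation_by toss h e e' u \/ violation_by toss h e' e u ->
  2 * K * quorum pr <=
    count toss (byz_coins byz K (e + offset e e')) + count toss (byz_coins byz K e')
    + count toss (map (@charged_coin n K) (charged pr byz A e e' h K toss u)).
Proof.
move=> ee' [] /violation_chains[b [b' [cb cb' bb']]]; first exact: conflict_count cb cb' bb'.
by apply: conflict_count cb' cb _ => // k kK /esym; exact: bb'.
Qed.

End Violation.

(** * Exponential moment of the number of votes *)

Section Bound.
Variables (R : realFieldType) (n : nat) (Tx Hash : eqType).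
Variables (pr : protocol n Tx Hash) (byz : {set 'I_n}) (A : adversary n Tx Hash).
Variables (bias : coin n -> R) (p x : R) (e e' h K : nat).
Hypothesis bias01 : forall c, 0 <= bias c <= 1.
Hypothesis bias_vote : forall v E, bias (VoteCoin v E) = p.
Hypothesis x_ge1 : 1 <= x.
Hypothesis ee' : (e <= e')%N.
Implicit Types (w : coin n -> bool).

(** [m] and [m2] are the means of [x ^ c] and [x ^ (2 * c)] for a coin [c] of bias [p]; [rho] is
    normalized to mean 1. *)
Let m := 1 + p * (x - 1).
Let m2 := 1 + p * (x ^+ 2 - 1).
Let weight (y : R) (i : bool) : R := if i then y else 1.
Let rho (i : bool) : R := weight x i / m.

Lemma prod_weight (y : R) w (L : seq (coin n)) :
  \prod_(c <- L) weight y (w c) = y ^+ count w L.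
Proof.
elim: L => [|c L IHL]; first by rewrite big_nil.
by rewrite big_cons IHL /weight /=; case: (w c); rewrite ?exprS ?mul1r.
Qed.

Lemma mean_weight (y : R) v E :
  bias (VoteCoin v E) * weight y true + (1 - bias (VoteCoin v E)) * weight y false =
  1 + p * (y - 1).
Proof. by rewrite bias_vote /weight; ring. Qed.

Lemma expect_byz_coins s w (y : R) (e0 : nat) : uniq s ->
  {subset byz_coins byz K e0 <= s} ->
  expect bias s (fun v => y ^+ count v (byz_coins byz K e0)) w =
  (1 + p * (y - 1)) ^+ (K * #|byz|).
Proof.
move=> us sub; rewrite -(size_byz_coins byz K e0).
transitivity (expect bias s
    (fun v => \prod_(c <- byz_coins byz K e0) weight y (v c)) w).
  by apply: eq_expect => v; rewrite prod_weight.
rewrite expect_prod ?uniq_byz_coins //.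
rewrite (eq_big_seq (fun=> 1 + p * (y - 1))).
  by rewrite big_const_seq count_predT iter_mulr_1.
by move=> c /mem_byz_coins[v [k [-> _ _]]]; exact: mean_weight.
Qed.

(** The martingale property: [expect_step] removes the latest charge, since its coin is fresh and
    affects neither the earlier factors nor [W]. *)
Lemma expect_charged s w (W : (coin n -> bool) -> R) u : uniq s ->
  0 < m ->
  (forall v E, (E <= e' + K)%N -> VoteCoin v E \in s) ->
  (forall v E y w, v \notin byz -> W (upd w (VoteCoin v E) y) = W w) ->
  expect bias s (fun v => W v *
    \prod_(c <- charged pr byz A e e' h K v u) rho (v (charged_coin c))) w =
  expect bias s W w.
Proof.
move=> us m0 Vs WV; elim: u => [|u <-].
  by apply: eq_expect => v; rewrite /= big_nil mulr1.
pose C v := omap (@charged_coin n K) (charge_at pr byz A e e' h K v u).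
rewrite -[RHS](expect_step (rho := rho) (C := C) _ us).
  apply: eq_expect => v; rewrite /C /=; case: charge_at => [c|] /=.
    by rewrite big_cons mulrCA.
  by rewrite mul1r.
move=> v c; rewrite /C; case ct: charge_at => [[[q E] k]|] //= [<-].
have cin : (q, E, k) \in charged pr byz A e e' h K v u.+1.
  by rewrite /= ct mem_head.
have [qc _ _ _] := charged_spec ee' cin.
split; first exact/Vs/(charged_epoch ee' cin).
  by rewrite /rho !mulrA -mulrDl mean_weight divff // gt_eqF.
move=> y; have [cy chy] := charge_at_upd ee' y ct.
rewrite -/(charged_coin (q, E, k)) cy chy; split => //.
rewrite {1}/charged_coin WV //; congr (_ * _); apply: eq_big_seq => c' c'in.
by rewrite upd_other // (charged_coin_fresh ee' ct c'in).
Qed.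

(** Exponential Markov inequality: on [Q], [x ^ N] is at most [x] to the number of counted heads,
    whose mean splits into a charged and a Byzantine factor. *)
Lemma expect_count_le s w u (Q : (coin n -> bool) -> Prop) N : uniq s ->
  0 <= p ->
  (forall v E, (E <= e' + K)%N -> VoteCoin v E \in s) ->
  (forall v, Q v -> N <= count v (byz_coins byz K (e + offset e e')) +
     count v (byz_coins byz K e') +
     count v (map (@charged_coin n K) (charged pr byz A e e' h K v u)))%N ->
  x ^+ N * expect bias s (fun v => `[<Q v>]%:R) w <=
  (m ^+ (n - #|byz|) * m2 ^+ #|byz|) ^+ K.
Proof.
move=> us p0 Vs HQ.
have m1 : 1 <= m by rewrite /m lerDl mulr_ge0 // subr_ge0.
have m0 : 0 < m by rewrite (lt_le_trans ltr01).
pose a v := count v (byz_coins byz K (e + offset e e')).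
pose a' v := count v (byz_coins byz K e').
(* The two lists of Byzantine coins may overlap, so the product of their weights is replaced by the
   mean of the squares, each with a moment given by [m2]. *)
pose W v : R := 2^-1 * ((x ^+ 2) ^+ a v) + 2^-1 * ((x ^+ 2) ^+ a' v).
pose Z v := \prod_(c <- charged pr byz A e e' h K v u) rho (v (charged_coin c)).
have byz_sub e0 : (e0 <= e' + 1)%N -> {subset byz_coins byz K e0 <= s}.
  by move=> e0e' c /mem_byz_coins[v [k [-> _ kK]]]; apply: Vs; lia.
have EW : expect bias s W w = m2 ^+ (K * #|byz|).
  rewrite expectD !expectZ !expect_byz_coins //; first by rewrite -/m2; field.
    by apply: byz_sub; rewrite addn1.
  apply: byz_sub. have := offsetP ee'. lia.
have EWZ : expect bias s (fun v => W v * Z v) w = m2 ^+ (K * #|byz|).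
  rewrite -EW expect_charged //.
  move=> v E y v' vc; rewrite /W /a /a'.
  by congr (_ * _ ^+ _ + _ * _ ^+ _); apply: eq_in_count => c /mem_byz_coins[q [k [-> qb _]]];
    rewrite upd_other //; apply: contraNneq vc => -[<- _].
rewrite exprMn -!exprM ![(_ * K)%N]mulnC -EWZ -expectZ -expectZ.
apply: le_expect => // v.
(* Normalizing the weights to [rho] costs one factor [m] per charge. *)
have charged_prod : \prod_(c <- charged pr byz A e e' h K v u) weight x (v (charged_coin c)) =
   m ^+ size (charged pr byz A e e' h K v u) * Z v.
  rewrite /Z; elim: charged => [|c r IHr]; first by rewrite !big_nil mul1r.
  rewrite !big_cons IHr /= exprS /rho; field. by rewrite gt_eqF.
have Z0 : 0 <= Z v.
  apply: prodr_ge0 => c _; rewrite /rho divr_ge0 ?(ltW m0) // /weight.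
  by case: ifP => // _; rewrite (le_trans ler01).
have W0 : 0 <= W v.
  by rewrite /W addr_ge0 // mulr_ge0 // ?invr_ge0 // !exprn_ge0 // (le_trans ler01).
case: asboolP => [/HQ QN|_]; last by rewrite mulr0 !mulr_ge0 // exprn_ge0 // ltW.
rewrite mulr1 (le_trans (ler_weXn2l x_ge1 QN)) // !exprD -/(a v) -/(a' v).
have -> : x ^+ count v [seq charged_coin i | i <- charged pr byz A e e' h K v u] =
    m ^+ size (charged pr byz A e e' h K v u) * Z v.
  by rewrite -charged_prod -prod_weight big_map.
(* [y * z <= (y ^ 2 + z ^ 2) / 2], from the square of [y - z]. *)
have ampm : x ^+ a v * x ^+ a' v <= W v.
  rewrite /W !(exprAC _ 2); move: (x ^+ a v) (x ^+ a' v) => y z {charged_prod}.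
  by have := sqr_ge0 (y - z); rewrite sqrrB mulr2n; lra.
rewrite mulrC -mulrA; apply: ler_pM.
- by rewrite exprn_ge0 // ltW.
- by rewrite mulr_ge0 // mulr_ge0 // exprn_ge0 // (le_trans ler01).
(* As [1 <= m], the random number of charges may be replaced by its upper bound. *)
- by apply: ler_weXn2l => //; rewrite size_charged.
- by rewrite mulrC ler_wpM2r.
Qed.

End Bound.

(** * The Chernoff estimate *)

Section Analysis.
Variable R : realType.

(** The claim is [f 1 <= f y] for [f t = ln t + 4 / (t + 1)], whose derivative is
    [(t - 1) ^ 2 / (t * (t + 1) ^ 2)]. *)
Lemma ln_ge_rational (y : R) : 1 <= y -> 2 * (y - 1) / (y + 1) <= ln y.
Proof.
move=> y1; pose f (t : R) := ln t + 4 * (t + 1)^-1.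
pose df (t : R) := t^-1 - 4 * (t + 1) ^- 2.
have fdf (t : R) : 0 < t -> is_derive t 1 f (df t).
  move=> t0; have t10 : t + 1 != 0 by rewrite gt_eqF // addr_gt0.
  have d1 : is_derive t 1 (fun t : R => t + 1) 1.
    by apply: is_derive_eq; rewrite addr0.
  have d2 := is_deriveV (f := fun t : R => t + 1) t10 d1.
  have d3 := is_derive1_ln t0.
  by apply: is_derive_eq; rewrite /df /GRing.scale /=; ring.
suff : f 1 <= f y.
  rewrite /f ln1; have -> : 2 * (y - 1) / (y + 1) = 2 - 4 * (y + 1)^-1.
    by field; lra.
  have -> : 0 + 4 * (1 + 1)^-1 = 2 :> R by field.
  lra.
have [||c] := @MVT_segment R f df 1 y y1.
- by move=> t; rewrite in_itv /= => /andP[t1 _]; apply: fdf; lra.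
- apply: derivable_within_continuous => t; rewrite in_itv /= => /andP[t1 _].
  by have dft := fdf t (lt_le_trans ltr01 t1); exact: ex_derive.
rewrite in_itv /= => /andP[c1 _] fE.
rewrite -subr_ge0 fE; apply: mulr_ge0; last by rewrite subr_ge0.
have -> : df c = (c - 1) ^+ 2 / (c * (c + 1) ^+ 2).
  by rewrite /df; field; apply/andP; split; lra.
by rewrite divr_ge0 ?sqr_ge0 // mulr_ge0 ?sqr_ge0 //; lra.
Qed.

(* [ln x] is the optimal Chernoff parameter, and [mu] will be [(n + f) * p / 2]. *)
Lemma chernoff_le (n b q : nat) (p mu delta : R) (x := Num.sqrt (1 + delta)) :
  0 <= p -> 0 <= delta -> (b <= n)%N -> (n + b)%:R * p <= 2 * mu ->
  q%:R = (1 + delta) * mu ->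
  (1 + p * (x - 1)) ^+ (n - b) * (1 + p * (x ^+ 2 - 1)) ^+ b <=
  x ^+ (2 * q) * expR (- (delta ^+ 2 * mu / (2 + delta))).
Proof.
move=> p0 d0 bn mu_ge qE.
have x2 : x ^+ 2 = 1 + delta by rewrite sqr_sqrtr //; lra.
have x0 : 0 <= x := sqrtr_ge0 _.
have mu0 : 0 <= mu.
  have : 0 <= (n + b)%:R * p by rewrite mulr_ge0.
  lra.
(* [x - 1 <= (x ^ 2 - 1) / 2 = delta / 2], so in the exponent a coin of weight 1 costs half as much
   as one of weight 2. *)
have le1 : (1 + p * (x - 1)) <= expR (p * delta / 2).
  apply: le_trans (expR_ge1Dx _); rewrite lerD2l -mulrA ler_wpM2l //.
  by have := sqr_ge0 (x - 1); rewrite sqrrB1 x2; lra.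
have le2 : (1 + p * (x ^+ 2 - 1)) <= expR (p * delta).
  by apply: le_trans (expR_ge1Dx _); rewrite x2 addrAC subrr add0r.
have x1 : 1 <= x.
  by rewrite -(ler_sqr (x := 1)) ?qualifE //= x2 expr1n; lra.
have xq : x ^+ (2 * q) = expR (q%:R * ln (1 + delta)).
  by rewrite exprM x2 expRM_natl lnK // posrE; lra.
rewrite xq -expRD.
apply: le_trans (_ : expR ((n - b)%:R * (p * delta / 2)) * expR (b%:R * (p * delta)) <= _).
  rewrite !expRM_natl; apply: ler_pM.
  - by rewrite exprn_ge0 // addr_ge0 // mulr_ge0 // subr_ge0.
  - by rewrite exprn_ge0 // x2 addr_ge0 // mulr_ge0 //; lra.
  - by rewrite lerXn2r // ?nnegrE ?expR_ge0 // addr_ge0 // mulr_ge0 // subr_ge0.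
  - by rewrite lerXn2r // ?nnegrE ?expR_ge0 // x2 addr_ge0 // mulr_ge0 //; lra.
rewrite -expRD ler_expR natrB // qE.
(* The exponents add up to [(n + b) * p * delta / 2]. *)
have mean : (n%:R - b%:R) * (p * delta / 2) + b%:R * (p * delta) <= mu * delta.
  have := ler_wpM2r d0 mu_ge; rewrite natrD; lra.
apply: le_trans mean _.
have := ln_ge_rational (y := 1 + delta); rewrite lerDl => /(_ d0) lnle.
have {}lnle : (1 + delta) * mu * (2 * delta / (2 + delta)) <= (1 + delta) * mu * ln (1 + delta).
  apply: ler_wpM2l; first by rewrite mulr_ge0 //; lra.
  by apply: le_trans lnle; rewrite le_eqVlt; apply/orP; left; apply/eqP; field; lra.
(* From [2 * delta * (1 + delta) - delta ^ 2 = delta * (2 + delta)]: the rational bound on [ln]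
   yields exactly the stated exponent. *)
have -> : mu * delta = (1 + delta) * mu * (2 * delta / (2 + delta)) - delta ^+ 2 * mu / (2 + delta).
  by field; lra.
by rewrite lerD2r.
Qed.

End Analysis.

(** * From bounded time to the whole execution *)

Theorem theorem4 (R : realType) (n : nat) (Tx Hash : eqType)
    (pr : protocol n Tx Hash) (byz : {set 'I_n}) (f : nat)
    (eps p_sample p_vote p_prop : R)
    (d : measure_display) (T : measurableType d) (P : probability T R)
    (toss : coin n -> T -> bool) (A : adversary n Tx Hash) (h e e' : nat)
    (hash_inj : injective (hash pr))
    (genesis_epoch : b_epoch (genesis pr) = 0%N)
    (genesis_height : b_height (genesis pr) = 0%N)
    (eps_ge0 : 0 <= eps) (eps_lt : eps < 3^-1)
    (f_eps : f%:R = eps * n%:R) (byz_le : (#|byz| <= f)%N)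
    (p_sample_gt0 : 0 < p_sample) (p_sample_le1 : p_sample <= 1)
    (p_vote_gt0 : 0 < p_vote) (p_vote_le1 : p_vote <= 1)
    (p_prop_gt0 : 0 < p_prop) (p_prop_le1 : p_prop <= 1)
    (toss_indep : independent_coins P (coin_bias p_sample p_vote p_prop) toss)
    (psync : forall w, partially_synchronous pr byz A (fun c => toss c w))
    (kappa_ge2 : (2 <= kappa pr)%N)
    (quorum_ge : (n + f)%:R * p_vote / 2 <= (quorum pr)%:R) :
  let delta := 2 * (quorum pr)%:R / ((n + f)%:R * p_vote) - 1 in
  (P [set w | safety_violation pr byz A (fun c => toss c w) h e e'] <=
   (2 ^+ (kappa pr).-1 *
    expR (- (delta ^+ 2 * (n + f)%:R * p_vote / (2 * (2 + delta))))
      ^+ (kappa pr).-1)%:E)%E.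
Proof.
cbv zeta; set delta := 2 * _ / _ - 1; set K := (kappa pr).-1.
pose mu := (n + f)%:R * p_vote / 2.
have n0 : (0 < n)%N by apply: leq_ltn_trans (ltn_ord (leader pr 0)).
have mu0 : 0 < mu by rewrite divr_gt0 // mulr_gt0 // ltr0n addn_gt0 n0.
have deltaE : 1 + delta = (quorum pr)%:R / mu.
  rewrite /delta /mu addrC subrK; field.
  by rewrite (gt_eqF p_vote_gt0) -natrD pnatr_eq0 addn_eq0 (gtn_eqF n0).
have d0 : 0 <= delta.
  suff : 1 <= 1 + delta by lra.
  by rewrite deltaE ler_pdivlMr // mul1r.
have qE : (quorum pr)%:R = (1 + delta) * mu by rewrite deltaE divfK // gt_eqF.
clearbody delta; have d2 : 2 + delta != 0 by rewrite gt_eqF // ltr_wpDr.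
have -> : delta ^+ 2 * (n + f)%:R * p_vote / (2 * (2 + delta)) =
          delta ^+ 2 * mu / (2 + delta).
  by rewrite /mu; field.
set tail := expR _.
have bias01 (c : coin n) : 0 <= coin_bias p_sample p_vote p_prop c <= 1.
  by case: c => * /=; rewrite ltW.
pose V u := [set w | violation_by pr byz A (fun c => toss c w) h e e' u].
have VE : [set w | safety_violation pr byz A (fun c => toss c w) h e e'] =
          \bigcup_u V u.
  apply/seteqP; split => w /=.
    by move=> /safety_violationE[u Vu]; exists u.
  by move=> [u _ Vu]; apply/safety_violationE; exists u.
have mV u : measurable (V u).
  have [M detV] := violation_by_determined pr byz A h e e' u.
  exact: (measurable_determined toss_indep detV).
have V_nd : nondecreasing_seq V.
  move=> u u' uu'; apply/subsetPset => w [t [t' [tu t'u Vtt']]].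
  by exists t, t'; split=> //; [exact: leq_trans tu uu'|exact: leq_trans t'u uu'].
(* The events [V u] increase to the violation, so continuity from below transfers a uniform bound;
   the factor [2 ^ K >= 1] only enlarges it. *)
suff PV u : (P (V u) <= (tail ^+ K)%:E)%E.
  rewrite VE; apply: (@le_trans _ _ (tail ^+ K)%:E).
    apply: (cvge_le _ (nondecreasing_cvg_mu mV (bigcup_measurable (fun u _ => mV u)) V_nd)).
    exact: nearW.
  by rewrite lee_fin ler_peMl ?exprn_ge0 ?expR_ge0 // exprn_ege1 // ler1n.
pose x := Num.sqrt (1 + delta).
have x1 : 1 <= x by rewrite -sqrtr1 ler_wsqrtr //; lra.
pose e1 := minn e e'; pose e2 := maxn e e'.
have e12 : (e1 <= e2)%N by rewrite geq_min leq_max leqnn.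
have [M1 detV] := violation_by_determined pr byz A h e e' u.
(* Large enough for the event and for every vote coin that can be charged or counted. *)
pose M := maxn M1 (e2 + K).+1.
have detM : determined_by (coins_below n M)
    (fun toss => violation_by pr byz A toss h e e' u).
  apply: determined_by_sub detV => c /time_coins_below cM1.
  by apply: mem_coins_below; rewrite leq_max cM1.
(* The constant [false] is a default assignment: every coin on which the event depends is tossed. *)
rewrite (probability_determined toss_indep (fun=> false) (undup_uniq _) detM) lee_fin.
have := @expect_count_le R n Tx Hash pr byz A _ p_vote x e1 e2 h K bias01
  (fun _ _ => erefl) x1 e12 (coins_below n M) (fun=> false) u
  (fun toss => violation_by pr byz A toss h e e' u) (2 * K * quorum pr)%N
  (undup_uniq _) (ltW p_vote_gt0).
set ex := expect _ _ _ _ => bound.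
have {bound} : x ^+ (2 * K * quorum pr) * ex <=
    ((1 + p_vote * (x - 1)) ^+ (n - #|byz|) * (1 + p_vote * (x ^+ 2 - 1)) ^+ #|byz|) ^+ K.
  apply: bound => [v E Ev|v Vv].
    by apply: mem_coins_below; rewrite leq_max /= ltnS Ev orbT.
  apply: violation_count => //.
  by rewrite /e1 /e2; case: (leqP e e') => _; [left|right].
have byzn : (#|byz| <= n)%N by rewrite -[n in (_ <= n)%N]card_ord max_card.
have chernoff : (1 + p_vote * (x - 1)) ^+ (n - #|byz|) *
    (1 + p_vote * (x ^+ 2 - 1)) ^+ #|byz| <= x ^+ (2 * quorum pr) * tail.
  apply: chernoff_le => //; first exact: ltW.
  have -> : 2 * mu = (n + f)%:R * p_vote by rewrite /mu; field.
  by rewrite ler_pM2r // ler_nat leq_add2l.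
have xge0 : 0 <= x by rewrite (le_trans ler01).
(* Regrouping the exponent as [(2 * quorum) * K] makes both sides [K]-th powers, so that [chernoff]
   can be applied to the base. *)
rewrite mulnAC exprM => bound.
have xK : 0 < (x ^+ (2 * quorum pr)) ^+ K by rewrite !exprn_gt0 // (lt_le_trans ltr01).
rewrite -(ler_pM2l xK) -exprMn (le_trans bound) //.
apply: lerXn2r => //; rewrite nnegrE.
  have xx : 1 <= x ^+ 2 by rewrite exprn_ege1.
  by rewrite mulr_ge0 // exprn_ge0 // addr_ge0 // mulr_ge0 ?(ltW p_vote_gt0) // subr_ge0.
by rewrite mulr_ge0 ?expR_ge0 // exprn_ge0.
Qed.
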